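(* Let $\eta\in L_2(\mathbb S^2)$ satisfy (A1) $\int_{\mathbb S^2}\frac{|\eta(\theta,\varphi)|}{1+\cos\theta}\,d\Sigma<\infty$, (A2) $\int_{\mathbb S^2}|\eta(\theta,\varphi)|\frac{\tan^2(\theta/2)}{1+\cos\theta}\,d\Sigma<\infty$, (A3) $\operatorname*{ess\,sup}_{(\theta,\varphi)\in\mathbb S^2}|\eta(\theta,\varphi)|\frac{1+\tan^2(\theta/2)}{1-\cos\theta}<\infty$, (C) $\int_{\mathbb S^2}\frac{\eta(\theta,\varphi)}{1+\cos\theta}\,d\Sigma=0$. Then the sequence $(G_\ell)_{\ell\in\mathbb N_0}$ is bounded.
   Context: $\mathbb S^2\subset\mathbb R^3$ is the unit sphere; points are written $\omega=(\theta,\varphi)=(\sin\theta\cos\varphi,\sin\theta\sin\varphi,\cos\theta)$ with $\theta\in[0,\pi]$, $\varphi\in[0,2\pi)$; $d\Sigma(\omega)=\sin\theta\,d\theta\,d\varphi$, $L_2(\mathbb S^2)=L_2(\mathbb S^2,\Sigma)$. For $a>0$ let $\omega_a=(\theta_a,\varphi)$ with $\theta_a\in[0,\pi]$, $\tan(\theta_a/2)=a\tan(\theta/2)$; $\kappa(a,\theta)=\frac{4a^2}{[(a^2-1)\cos\theta+(a^2+1)]^2}$; $(D_af)(\omega)=\kappa(a,\theta)^{1/2}f(\omega_{1/a})$; $\eta_a:=D_a\eta$. Spherical harmonics $Y_\ell^m(\theta,\varphi)=\sqrt{\frac{2\ell+1}{4\pi}\frac{(\ell-m)!}{(\ell+m)!}}P_\ell^m(\cos\theta)e^{im\varphi}$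 form an orthonormal basis; $\Pi_\ell$ is the orthogonal projection onto $\mathrm{span}\{Y_\ell^m:|m|\le\ell\}$. $G_\ell=\frac1{2\ell+1}\int_0^\infty\|\Pi_\ell\eta_a\|^2\frac{da}{a^3}\in[0,\infty]$. *)

(* Defs.v *)
From HB Require Import structures.
From mathcomp Require Import all_boot all_order all_algebra.
From mathcomp Require Import all_classical all_reals all_analysis.
From mathcomp Require Import ess_sup_inf.

Set Implicit Arguments.
Unset Strict Implicit.
Unset Printing Implicit Defensive.

Import Order.TTheory GRing.Theory Num.Theory Num.Def.
Import numFieldNormedType.Exports.

Local Open Scope classical_set_scope.
Local Open Scope ring_scope.

Section Sphere.
Variable R : realType.

(* Spherical coordinates (theta, phi) : R * R; the parameter domain of S^2. *)
Definition sdom : set (R * R) := `[0, pi] `*` `[0, 2 * pi[.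

Definition leb2 := ((@lebesgue_measure R) \x (@lebesgue_measure R))%E.

(* \int_{S^2} f dSigma, with dSigma = sin(theta) dtheta dphi  (extended real). *)
Definition sint (f : R * R -> R) : \bar R :=
  (\int[leb2]_(x in sdom) (f x * sin x.1)%:E)%E.

Definition Rsint (f : R * R -> R) : R := fine (sint f).

(* A complex-valued function on S^2 is given by its real part u and its
   imaginary part v (functions of (theta, phi)). *)
Definition cabs (u v : R * R -> R) (x : R * R) : R := Num.sqrt (u x ^+ 2 + v x ^+ 2).

Definition L2S2 (u v : R * R -> R) : Prop :=
  measurable_fun sdom u /\ measurable_fun sdom v /\
  (sint (fun x => (u x ^+ 2 + v x ^+ 2)%R) < +oo)%E.

(* Essential supremum over S^2 of a nonnegative function g.  Sigma-null subsets
   of the parameter domain are exactly the Lebesgue-null ones (sin > 0 on (0,pi)). *)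
Definition ess_sup_S2 (g : R * R -> R) : \bar R :=
  ess_sup leb2 (fun x => (if x \in sdom then g x else 0)%:E).

(* theta_a : tan(theta_a/2) = a tan(theta/2), theta_a in [0,pi] *)
Definition theta_a (a t : R) : R :=
  if t == pi then pi else 2 * atan (a * tan (t / 2)).

Definition kappa (a t : R) : R :=
  4 * a ^+ 2 / ((a ^+ 2 - 1) * cos t + (a ^+ 2 + 1)) ^+ 2.

Definition dil (a : R) (f : R * R -> R) (x : R * R) : R :=
  Num.sqrt (kappa a x.1) * f (theta_a a^-1 x.1, x.2).

(* Associated Legendre function P_l^m, -l <= m <= l, Rodrigues formula
   P_l^m(x) = (-1)^m / (2^l l!) (1-x^2)^{m/2} d^{l+m}/dx^{l+m} (x^2-1)^l. *)
Definition legendreP (l : nat) (m : int) (x : R) : R :=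
  (-1) ^ m / (2 ^+ l * (l`!)%:R) * powR (1 - x ^+ 2) (m%:~R / 2) *
  ((('X ^+ 2 - 1) ^+ l : {poly R})^`(absz (l%:Z + m))).[x].

Definition Ynorm (l : nat) (m : int) : R :=
  Num.sqrt (((2 * l + 1)%N%:R) / (4 * pi) *
            ((absz (l%:Z - m))`!)%:R / ((absz (l%:Z + m))`!)%:R).

(* Y_l^m(theta,phi) = Ynorm l m * P_l^m(cos theta) * e^{i m phi};
   real part and imaginary part *)
Definition Yre (l : nat) (m : int) (x : R * R) : R :=
  Ynorm l m * legendreP l m (cos x.1) * cos (m%:~R * x.2).
Definition Yim (l : nat) (m : int) (x : R * R) : R :=
  Ynorm l m * legendreP l m (cos x.1) * sin (m%:~R * x.2).

(* <f, Y_l^m> = \int f conj(Y_l^m) dSigma, f = u + i v: real and imaginary parts *)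
Definition coefRe (u v : R * R -> R) (l : nat) (m : int) : R :=
  Rsint (fun x => u x * Yre l m x + v x * Yim l m x).
Definition coefIm (u v : R * R -> R) (l : nat) (m : int) : R :=
  Rsint (fun x => v x * Yre l m x - u x * Yim l m x).

(* || Pi_l f ||^2 = sum_{|m| <= l} |<f, Y_l^m>|^2  (Y_l^m orthonormal) *)
Definition projnorm2 (u v : R * R -> R) (l : nat) : R :=
  \sum_(i < (2 * l).+1)
    (coefRe u v l (i%:Z - l%:Z) ^+ 2 + coefIm u v l (i%:Z - l%:Z) ^+ 2).

Definition G (u v : R * R -> R) (l : nat) : \bar R :=
  (((2 * l + 1)%N%:R)^-1)%:E *
  (\int[@lebesgue_measure R]_(a in [set a : R | (0 < a)%R])
      (projnorm2 (dil a u) (dil a v) l / a ^+ 3)%:E)%E.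

End Sphere.

(* Main.v *)
(* (A3) says that |eta| <= C sin^2 theta almost everywhere.  The substitution
   tau = theta_{1/a}, whose Jacobian is exactly kappa^(1/2), turns <eta_a, Y_l^m>
   into 2a times the integral over tau of Q_m(a tan(tau/2)) g_m(tau), where g_m is
   the m-th Fourier coefficient of eta tan(tau/2) on the parallel tau.
   Cauchy-Schwarz, Tonelli and the scale invariance of da/a then bound the
   a-integral by the integral of |g_m|^2 times that of Q_m(b)^2 db/b, and the sum
   over m is controlled by Bessel's inequality.  It remains to bound the integral
   of Q_m^2 db/b by a multiple of 2l+1.
   For m <> 0 this integral is at most a normalized integral of
   (P_l^m)^2 / (1 - x^2) over [-1, 1], which the ladder relation between P_l^m and
   P_{l-1}^m keeps bounded in l.
   For m = 0 it diverges at b = 0; but by (C) g_0 has mean zero, so that a cutoff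
   in a alone, at a = (l(l+1)+2)^(-1/2), can be subtracted from the kernel.  What is
   left is bounded because 1 - P_l(x) <= l(l+1)(1 - x) below the cutoff and because
   a monotone energy of the Legendre equation makes P_l^2 db/b integrable above it. *)

Require Import Defs.
From HB Require Import structures.
From mathcomp Require Import all_boot all_order all_algebra.
From mathcomp Require Import all_classical all_reals all_analysis.
From mathcomp Require Import measurable_realfun ess_sup_inf.
From mathcomp Require Import ring lra zify.
Import Order.TTheory GRing.Theory Num.Theory Num.Def.
Import numFieldNormedType.Exports.
Local Open Scope ring_scope.

Set Implicit Arguments.
Unset Strict Implicit.
Unset Printing Implicit Defensive.

(** * Derivatives of (X^2 - 1)^l: differential equation, ladder relation, weighted squares *)

Section Rodrigues.
Variable R : realFieldType.
Implicit Types (l m n k : nat) (x : R).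

(** Condition (C) annihilates only kernels that depend on [a] alone, whereas the divergence at b = 0
    calls for a cutoff in b = a tan(tau/2). Exchanging one cutoff for the other costs the
    da/a-length of the interval between them, |ln s| with s = tan(tau/2), estimated here by s + 1/s
    = 2 / sin tau. The loss is affordable because Bessel's inequality leaves a factor sin^2 tau,
    inherited from (A3). The cutoff sits where l(l+1) b^2 is of order 1, that is where P_l stops
    being close to 1, so that both sides of it contribute a bounded amount uniformly in l. Square
    integrals of Legendre functions are treated algebraically: explicit polynomials serve as
    primitives, and integrals become boundary values. Two devices keep the measure theory light. The
    substitution tau = theta_{1/a} is extended to a diffeomorphism of the whole line, and eta is
    changed on a null set so that its bound by C sin^2 theta holds everywhere, which makes eta
    tan(tau/2) and its Fourier coefficients bounded. *)

Definition rodr l n : {poly R} := (('X ^+ 2 - 1) ^+ l)^`(n).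

Arguments rodr : simpl never.

Lemma rodrS l n : rodr l n.+1 = (rodr l n)^`().
Proof. by rewrite /rodr derivnS. Qed.

Lemma deriv_rodr0 l : (rodr l.+1 0)^`() = (2 * l.+1%:R) *: ('X * rodr l 0).
Proof.
rewrite /rodr !derivn0 deriv_exp derivB derivC subr0 derivXn /=.
by rewrite -mulr_natl -mul_polyC polyCM polyC_natr polyC_natr; ring.
Qed.

(** For y = (X^2 - 1)^l one has (X^2 - 1) y' = 2 l X y; differentiating this n + 1 times gives the
    equation. *)
Lemma rodr_ode l n :
  ('X ^+ 2 - 1) * rodr l n.+2 + (2 * (n.+1%:R - l%:R)) *: ('X * rodr l n.+1)
  = (n.+1%:R * (2 * l%:R - n%:R)) *: rodr l n.
Proof.
elim: n => [|n IH].
  have h : ('X ^+ 2 - 1) * rodr l 1 = (2 * l%:R) *: ('X * rodr l 0).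
    case: l => [|l]; first by rewrite mulr0 scale0r /rodr derivnS derivn0 expr0 derivC mulr0.
    have -> : rodr l.+1 0 = ('X ^+ 2 - 1) * rodr l 0 by rewrite /rodr !derivn0 exprS.
    by rewrite rodrS deriv_rodr0 -!mul_polyC; ring.
  have := congr1 (@deriv R) h.
  rewrite derivM derivB derivC subr0 derivXn /= derivZ derivM derivX mul1r -!rodrS.
  rewrite expr1 => h1; move: h1.
  rewrite -!mul_polyC !(polyCM, polyCB, polyCD, polyC_natr) => h1.
  apply/eqP; rewrite -subr_eq0; apply/eqP.
  move/eqP: h1; rewrite -subr_eq0 => /eqP h1.
  by rewrite -[RHS]h1; ring.
have := congr1 (@deriv R) IH.
rewrite derivD derivM !derivZ derivB derivC subr0 derivXn /= derivM derivX mul1r -!rodrS expr1.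
rewrite -!mul_polyC !(polyCM, polyCB, polyCD, polyC_natr) => h1.
apply/eqP; rewrite -subr_eq0; apply/eqP.
move/eqP: h1; rewrite -subr_eq0 => /eqP h1.
by rewrite -[RHS]h1; ring.
Qed.

(** The case n = 0 is X^2 - (X^2 - 1) = 1; every further differentiation lowers the scalar
    coefficient by one. *)
Lemma rodr_lower l n :
  'X * rodr l.+1 n.+1 - (2 * l.+1%:R - n%:R) *: rodr l.+1 n = (2 * l.+1%:R) *: rodr l n.
Proof.
elim: n => [|n IH].
  rewrite rodrS deriv_rodr0 subr0.
  have -> : rodr l.+1 0 = ('X ^+ 2 - 1) * rodr l 0 by rewrite /rodr !derivn0 exprS.
  rewrite -!mul_polyC; ring.
have := congr1 (@deriv R) IH.
rewrite derivB derivM !derivZ derivX mul1r -!rodrS.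
rewrite -!mul_polyC !(polyCM, polyCB, polyCD, polyC_natr) => h1.
by rewrite -h1; ring.
Qed.

(** Elimination of [rodr l.+1 n] between [rodr_ode] and [rodr_lower]. For n = l + m the relation
    lowers the degree of the Legendre function from l + 1 to l at fixed order m. *)
Lemma rodr_ladder l n :
  (1 - 'X ^+ 2) * rodr l.+1 n.+2 + (2 * l.+1%:R - n.+1%:R) *: ('X * rodr l.+1 n.+1)
  = (2 * l.+1%:R * n.+1%:R) *: rodr l n.
Proof.
have h1 := rodr_ode l.+1 n; have h2 := rodr_lower l n.
move: h1 h2; rewrite -!mul_polyC !(polyCM, polyCB, polyCD, polyC_natr) => h1 h2.
rewrite mulrAC -h2.
move/eqP: h1; rewrite -subr_eq0 => /eqP h1.
apply/eqP; rewrite -subr_eq0; apply/eqP; rewrite -[RHS]oppr0 -h1; ring.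
Qed.

Lemma rodr_sqr1_eq0 l n x : x ^+ 2 = 1 -> (n < l)%N -> (rodr l n).[x] = 0.
Proof.
move=> x1; elim: l n => // l IH [_|n].
  by rewrite /rodr derivn0 exprS hornerM !hornerE x1 subrr mul0r.
rewrite ltnS => nl.
have := congr1 (horner^~ x) (rodr_ladder l n).
rewrite !hornerE x1 subrr mul0r add0r IH // mulr0 => /eqP.
rewrite !mulf_eq0 -orbA => /or3P[|/eqP x0|/eqP r0 //].
  rewrite subr_eq0 -natrM eqr_nat => /eqP; lia.
by move: x1; rewrite x0 expr0n => /esym/eqP; rewrite oner_eq0.
Qed.

Lemma rodr_sqr1_diag l x : x ^+ 2 = 1 -> (rodr l l).[x] = (2 * x) ^+ l * l`!%:R.
Proof.
move=> x1; elim: l => [|l IH]; first by rewrite /rodr derivn0 !expr0 hornerC mulr1.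
have := congr1 (horner^~ x) (rodr_ladder l l).
rewrite !hornerE x1 subrr mul0r add0r IH /= => h.
have c0 : l.+1%:R != 0 :> R by rewrite pnatr_eq0.
rewrite factS exprS natrM.
move: (l.+1%:R) c0 h => c c0 h.
(* The ladder relation at x determines x times the value; multiplying by x^2 = 1 removes the extra
   x. *)
apply: (mulfI c0); transitivity (c * (x ^+ 2 * (rodr l.+1 l.+1).[x])).
  by rewrite x1 mul1r.
transitivity (x * (2 * c * c * ((2 * x) ^+ l * (l`!)%:R))); last by ring.
by rewrite -h; ring.
Qed.

Lemma poly_deriv0_eq (p : {poly R}) x : p^`() = 0 -> p.[x] = 0 -> p = 0.
Proof.
move=> p0 px; have pE : p = (p`_0)%:P.
  apply/polyP => -[|i]; rewrite coefC //=; apply/eqP.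
  have := congr1 (fun q : {poly R} => q`_i) p0.
  by rewrite coef_deriv coef0 => /eqP; rewrite mulrn_eq0.
by move: px; rewrite pE hornerC => ->.
Qed.

(* The weight (X^2-1)^(m+1) puts the equation of [rodr_ode] in self-adjoint
   form, so the two sides have proportional derivatives and both vanish at 1. *)
Lemma rodr_neg l m : (m <= l)%N ->
  (l + m)`!%:R *: rodr l (l - m) = (l - m)`!%:R *: (('X ^+ 2 - 1) ^+ m * rodr l (l + m)).
Proof.
elim: m => [_|m IH ml]; first by rewrite subn0 addn0 mul1r.
have {}IH := IH (ltnW ml).
apply/eqP; rewrite -subr_eq0; apply/eqP; apply: (@poly_deriv0_eq _ 1); last first.
  rewrite !hornerE rodr_sqr1_eq0 ?expr1n ?exprS //=; last by lia.
  by rewrite !hornerE subrr expr0n /=; ring.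
apply/eqP; rewrite derivB !derivZ -rodrS subr_eq0; apply/eqP.
have -> : (l - m.+1).+1 = (l - m)%N by lia.
rewrite addnS factS natrM -scalerA IH.
have ode := rodr_ode l (l + m).
rewrite derivM deriv_exp derivB derivC subr0 derivXn /= -rodrS.
have -> : ((l - m)`!)%:R = (l - m)%:R * ((l - m.+1)`!)%:R :> R.
  by rewrite -natrM; congr (_%:R); have -> : (l - m)%N = (l - m.+1).+1 by lia.
transitivity (((l - m.+1)`!)%:R *: (('X^2 - 1) ^+ m *
   (('X^2 - 1) * rodr l (l + m).+2
     + (2 * ((l + m).+1%:R - l%:R)) *: ('X * rodr l (l + m).+1)))).
  rewrite ode.
  have -> : (2 * l%:R - (l + m)%:R : R) = (l - m)%:R by rewrite natrB 1?ltnW // natrD; ring.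
  rewrite -!mul_polyC !(polyCM, polyCB, polyCD, polyC_natr); ring.
rewrite -!mul_polyC !(polyCM, polyCB, polyCD, polyC1, polyC_natr) [_ ^+ m.+1]exprS.
rewrite expr1; ring.
Qed.

(* The associated Legendre function is, up to a constant, [sg ^ (m/2) * rodr l (l+m)]. *)
Definition sg : {poly R} := 1 - 'X ^+ 2.

Lemma deriv_sgS k : (sg ^+ k.+1)^`() = - (2 * k.+1%:R) *: ('X * sg ^+ k).
Proof.
rewrite deriv_exp /sg derivB derivC sub0r derivXn /= expr1 -mulr_natl -mul_polyC.
by rewrite !(polyCM, polyCN, polyC_natr); ring.
Qed.

(** Integration by parts gives (2k + 3) I_{k+1} = (2k + 2) I_k for the integrals I_k of (1 - x^2)^k
    over [-1, 1], so they stay below I_0 = 2. A polynomial primitive is produced so that the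
    argument remains algebraic. *)
Lemma sg_primitive k : exists2 H : {poly R},
  H^`() = sg ^+ k & 0 <= H.[1] - H.[-1] <= 2.
Proof.
elim: k => [|k [H dH /andP[H0 H2]]].
  exists 'X; first by rewrite derivX.
  by rewrite !hornerE; apply/andP; split; lra.
have cp : (0 < 2 * k.+1%:R + 1 :> R) by rewrite ltr_wpDl // mulr_ge0.
have c0 := lt0r_neq0 cp.
exists ((2 * k.+1%:R + 1)^-1 *: ('X * sg ^+ k.+1 + (2 * k.+1%:R) *: H)).
  apply: (scalerI c0); rewrite derivZ scalerA divff // scale1r derivD derivZ dH derivM derivX deriv_sgS.
  rewrite -!mul_polyC exprS /sg !(polyCM, polyCD, polyCN, polyC_natr); ring.
rewrite !hornerE sqrrN !expr1n !subrr !expr0n /= !mulr0 !add0r -mulrBr -mulrBr.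
apply/andP; split.
  by rewrite mulr_ge0 ?invr_ge0 ?(ltW cp) //; apply: mulr_ge0 => //; apply: mulr_ge0.
rewrite mulrC ler_pdivrMr //.
have k0 : 0 <= k.+1%:R :> R by [].
by nra.
Qed.

(** The case m = l of [rodr_neg], with (X^2 - 1)^l cancelled. *)
Lemma rodr_top l : rodr l (l + l) = (l + l)`!%:R%:P.
Proof.
have := rodr_neg (leqnn l).
rewrite subnn fact0 scale1r [rodr l 0]derivn0 => h.
have p0 : ('X^2 - 1 : {poly R}) ^+ l != 0.
  apply/expf_neq0/eqP => /(congr1 (horner^~ 0)).
  by rewrite !hornerE expr0n /= sub0r => /eqP; rewrite oppr_eq0 oner_eq0.
by apply: (mulfI p0); rewrite -h -mul_polyC mulrC.
Qed.

Lemma fact_double_le n : ((n + n)`! <= 4 ^ n * n`! ^ 2)%N.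
Proof.
elim: n => // n IH; rewrite addSn addnS !factS expnS.
have := leq_mul (leqnn (4 * n.+1 ^ 2)%N) IH.
by move: ((n + n)`!) (4 ^ n)%N (n`!) => a b c; nia.
Qed.

(** With l = d + m + 1 and order m + 1, the integrand is (P_l^{m+1})^2 / (1 - x^2) up to
    normalization. The induction raises the degree at fixed order; each step multiplies the integral
    by exactly the factor by which the bound grows, so the only loss occurs at d = 0. *)
Lemma sg_rodr_primitive m d : exists2 H : {poly R},
  H^`() = sg ^+ m * rodr (d + m.+1) (d + m.+1 + m.+1) ^+ 2
  & H.[1] - H.[-1] <= 2 * (2 ^+ (d + m.+1) * (d + m.+1)`!%:R) ^+ 2
       * (d + m.+1 + m.+1)`!%:R / d`!%:R.
Proof.
elim: d => [|d [H dH HB]].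
  have [H dH /andP[H0 H2]] := sg_primitive m.
  exists (((m.+1 + m.+1)`!%:R ^+ 2) *: H).
    by rewrite add0n rodr_top derivZ dH -mul_polyC polyC_exp mulrC.
  rewrite add0n fact0 divr1 !hornerZ -mulrBr.
  have := fact_double_le m.+1; move: ((m.+1 + m.+1)`!) => N hN.
  (* At d = 0 the derivative is the constant (2m + 2)!, and the bound reduces to (2M)! <= (2^M M!)^2
     for M = m + 1. *)
  have : N%:R <= (2 ^+ m.+1 * m.+1`!%:R) ^+ 2 :> R.
    by rewrite -natrX -natrM -natrX ler_nat expnMn -expnM [(m.+1 * 2)%N]mulnC expnM.
  move: ((2 ^+ m.+1 * m.+1`!%:R) ^+ 2) => K NK.
  have N0 : 0 <= N%:R :> R by [].
  apply: (@le_trans _ _ (N%:R * N%:R * 2)).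
    by rewrite expr2; apply: ler_wpM2l => //; apply: mulr_ge0.
  by have := ler_wpM2r N0 NK; nra.
set l := (d + m.+1)%N in dH HB *.
set n := (l + m.+1)%N in dH HB *.
rewrite !addSn -/l -/n.
set y := rodr l.+1 n.+1.
have ode := rodr_ode l.+1 n.+1; rewrite -/y in ode.
have lad := rodr_ladder l n; rewrite -/y in lad.
have n0 : n.+1%:R != 0 :> R by rewrite pnatr_eq0.
have d0 : d.+1%:R != 0 :> R by rewrite pnatr_eq0.
(* By the ladder relation [W] is a constant times [sg ^+ m.+1 * y * rodr l n]. It is the boundary
   term linking the integrands of degrees l + 1 and l, and it vanishes at 1 and -1. *)
pose W : {poly R} := sg ^+ m.+2 * y * y^`() + d.+1%:R *: ('X * sg ^+ m.+1 * y ^+ 2).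
have E1 : (2 * l.+1%:R - n.+1%:R) = d.+1%:R :> R.
  by rewrite /n /l -!natr1 !natrD -!natr1; ring.
have E2 : (2 * (n.+2%:R - l.+1%:R)) = 2 * m.+2%:R :> R.
  by rewrite /n /l -!natr1 !natrD -!natr1; ring.
have E3 : n.+1%:R = l.+1%:R + m.+1%:R :> R by rewrite /n -!natr1 !natrD -!natr1; ring.
have E4 : l.+1%:R = d.+1%:R + m.+1%:R :> R by rewrite /l -!natr1 !natrD -!natr1; ring.
have dW : W^`() = (2 * l.+1%:R * n.+1%:R) ^+ 2 *: (sg ^+ m * rodr l n ^+ 2)
   - (d.+1%:R * n.+1%:R) *: (sg ^+ m * y ^+ 2).
  have -> : (2 * l.+1%:R * n.+1%:R) ^+ 2 *: (sg ^+ m * rodr l n ^+ 2)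
     = sg ^+ m * (sg * y^`() + d.+1%:R *: ('X * y)) ^+ 2.
    by rewrite -E1 /sg -rodrS lad -!mul_polyC polyC_exp; ring.
  (* A multiple of the differential equation, which is zero, is subtracted to cancel the second
     derivative of [y]. *)
  transitivity (sg ^+ m * (sg * y^`() + d.+1%:R *: ('X * y)) ^+ 2
     - (d.+1%:R * n.+1%:R) *: (sg ^+ m * y ^+ 2)
     - sg ^+ m.+1 * y * (('X^2 - 1) * rodr l.+1 n.+3 + (2 * (n.+2%:R - l.+1%:R)) *: ('X * rodr l.+1 n.+2)
      - (n.+2%:R * (2 * l.+1%:R - n.+1%:R)) *: y)); last by rewrite ode subrr mulr0 subr0.
  rewrite /W derivD derivZ 2!derivM (derivM ('X * _)) (derivM 'X) derivX !deriv_sgS deriv_exp.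
  rewrite -!rodrS E1 E2; set y1 := rodr _ n.+2; set y2 := rodr _ n.+3.
  rewrite -(natr1 n.+1) E3 E4 -!mul_polyC /= -mulr_natl !exprS expr0 mulr1 /sg.
  rewrite !(polyCM, polyCD, polyCN, polyC1, polyC_natr); ring.
have s1 (x : R) : x ^+ 2 = 1 -> W.[x] = 0.
  move=> x1; have sx : sg.[x] = 0 by rewrite /sg !hornerE x1 subrr.
  rewrite /W hornerD hornerZ 5!hornerM !horner_exp sx !expr0n /=; ring.
clearbody W.
exists ((d.+1%:R * n.+1%:R)^-1 *: ((2 * l.+1%:R * n.+1%:R) ^+ 2 *: H - W)).
  rewrite derivZ derivB dW derivZ dH opprB addrC subrK scalerA mulVf ?mulf_neq0 //.
  by rewrite scale1r.
rewrite !(hornerZ, hornerD, hornerN) !s1 ?sqrrN ?expr1n // !subr0 -mulrBr -mulrBr.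
rewrite !factS !natrM.
have f0 : d`!%:R != 0 :> R by rewrite pnatr_eq0 -lt0n fact_gt0.
have dp : 0 < d.+1%:R :> R by [].
have np : 0 < n.+1%:R :> R by [].
apply: (@le_trans _ _ ((d.+1%:R * n.+1%:R)^-1 * ((2 * l.+1%:R * n.+1%:R) ^+ 2 *
   (2 * (2 ^+ l * l`!%:R) ^+ 2 * n`!%:R / d`!%:R)))).
  apply: ler_wpM2l; first by rewrite invr_ge0 mulr_ge0.
  by apply: ler_wpM2l HB; rewrite exprn_ge0 // !mulr_ge0.
rewrite le_eqVlt; apply/orP; left; apply/eqP; rewrite [2 ^+ l.+1]exprS.
move: (n.+1%:R) (d.+1%:R) (d`!%:R) n0 d0 f0 => a b c a0 b0 c0.
by field; rewrite a0 b0 c0.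
Qed.
End Rodrigues.

(** * Legendre polynomials: pointwise bounds from monotone quantities *)

Section LegendrePoly.
Variable R : realType.
Implicit Types (l : nat) (x : R) (p : {poly R}).

Let horner1 x : (1 : {poly R}).[x] = 1.
Proof. exact: hornerC. Qed.

Let hE := (horner1, horner_exp, hornerM, hornerD, hornerN, hornerX, hornerC).

Lemma poly_ndecr p (a b x y : R) :
  (forall z, a < z < b -> 0 <= p^`().[z]) -> a <= x -> x <= y -> y <= b -> p.[x] <= p.[y].
Proof.
move=> dp ax xy yb; apply: (@ger0_derive1_ndecr R (horner p) a b) => //.
- move=> z; rewrite in_itv /= => zab.
  by rewrite derive1E (@derive_val _ _ _ _ _ _ _ (is_derive_poly p z)) dp.
- by apply: continuous_subspaceT => z; exact: continuous_horner.
Qed.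

Definition legp l : {poly R} := (2 ^+ l * l`!%:R)^-1 *: rodr R l l.

Definition lam l : R := (l * l.+1)%:R.

Lemma lam_ge0 l : 0 <= lam l. Proof. by []. Qed.

Lemma two_fact_neq0 l : 2 ^+ l * l`!%:R != 0 :> R.
Proof. by rewrite mulf_neq0 ?expf_neq0 // pnatr_eq0 -lt0n fact_gt0. Qed.

Lemma legp_ode l : sg R * (legp l)^`()^`() = 2%:P * 'X * (legp l)^`() - (lam l)%:P * legp l.
Proof.
rewrite /legp !derivZ -!rodrS.
have := rodr_ode R l l; rewrite -!mul_polyC /lam /sg => ode.
set c := ((_)^-1)%:P.
have -> : (1 - 'X^2) * (c * rodr R l l.+2) = - c * (('X^2 - 1) * rodr R l l.+2 +
   (2 * (l.+1%:R - l%:R))%:P * ('X * rodr R l l.+1)) + c * (2%:P * 'X * rodr R l l.+1).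
  have -> : (2 * (l.+1%:R - l%:R)) = 2 :> R by ring.
  by ring.
rewrite ode natrM !(polyCM, polyCB, polyCD, polyC_natr); ring.
Qed.

Lemma legp_sqr1 l x : x ^+ 2 = 1 -> (legp l).[x] = x ^+ l.
Proof.
move=> x1; rewrite hornerZ rodr_sqr1_diag // exprMn.
have := two_fact_neq0 l; move: (2 ^+ l) (l`!%:R) => a b ab0.
by rewrite mulrAC mulrA mulVf ?mul1r.
Qed.

Lemma legp0 : legp 0 = 1.
Proof. by rewrite /legp /rodr derivn0 !expr0 fact0 mulr1 invr1 scale1r. Qed.



Lemma legp1 l : (legp l).[1] = 1. Proof. by rewrite legp_sqr1 ?expr1n. Qed.

(** Its derivative 2 x P'^2 has the sign of x, so on [-1, 1] it is largest at the endpoints, where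
    it equals [lam l]. *)
Definition legp_energy l : {poly R} := (lam l)%:P * legp l ^+ 2 + sg R * (legp l)^`() ^+ 2.

Lemma deriv_legp_energy l : (legp_energy l)^`() = 2%:P * 'X * (legp l)^`() ^+ 2.
Proof.
rewrite /legp_energy derivD (derivM (lam l)%:P) derivC (derivM (sg R)) !deriv_exp /=.
have dsg : (sg R)^`() = - (2%:P * 'X).
  by rewrite /sg derivB derivC derivXn /= expr1 sub0r -mulr_natl polyC_natr.
have := legp_ode l; rewrite dsg; move: (legp l)^`() => p1.
move: (legp l) (lam l)%:P (2%:P * 'X) => p L D ode.
rewrite !expr1 mul0r add0r.
have -> : sg R * (p1^`() * p1 *+ 2) = (sg R * p1^`()) * p1 *+ 2 by ring.
by rewrite ode; ring.
Qed.

Lemma legp_energy_le l x : -1 <= x <= 1 ->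
  lam l * (legp l).[x] ^+ 2 + (1 - x ^+ 2) * (legp l)^`().[x] ^+ 2 <= lam l.
Proof.
move=> /andP[x1 x2].
have E y : (legp_energy l).[y] = lam l * (legp l).[y] ^+ 2 + (1 - y ^+ 2) * (legp l)^`().[y] ^+ 2.
  by rewrite /legp_energy /sg !hE.
have E1 y : y ^+ 2 = 1 -> (legp_energy l).[y] = lam l.
  by move=> y1; rewrite E legp_sqr1 // exprAC y1 expr1n subrr mul0r addr0 mulr1.
have dE y : (legp_energy l)^`().[y] = 2 * y * (legp l)^`().[y] ^+ 2.
  by rewrite deriv_legp_energy !hE.
rewrite -E; have [x0|/ltW x0] := leP 0 x.
  rewrite -(E1 1) ?expr1n //; apply: (@poly_ndecr _ 0 1) => // z /andP[z0 z1].
  by rewrite dE; apply: mulr_ge0; [nra|exact: sqr_ge0].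
rewrite -(E1 (-1)) ?sqrrN ?expr1n //.
rewrite -lerN2 -!hornerN; apply: (@poly_ndecr _ (-1) 0) => // z /andP[z0 z1].
rewrite derivN hornerN dE.
by have := sqr_ge0 ((legp l)^`().[z]); nra.
Qed.

Lemma legp_sqr_le1 l x : -1 <= x <= 1 -> (legp l).[x] ^+ 2 <= 1.
Proof.
(* In degree 0 [lam] vanishes and the energy inequality gives no information on P. *)
case: l => [|l] x1.
  by rewrite legp0 hornerC expr1n.
have := legp_energy_le l.+1 x1.
have L0 : 0 < lam l.+1 by rewrite ltr0n.
have : 0 <= (1 - x ^+ 2) * (legp l.+1)^`().[x] ^+ 2.
  by apply: mulr_ge0; [nra|exact: sqr_ge0].
by nra.
Qed.

Lemma legp_le1 l x : -1 <= x <= 1 -> (legp l).[x] <= 1.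
Proof. by move=> /(legp_sqr_le1 l); nra. Qed.

(** The polynomial q = (1 - x^2) P' + lam x has derivative lam (1 - P) >= 0, and q(1) = lam. Hence
    (1 + z) P'(z) <= lam, so P' <= lam on [0, 1), and lam x - P is nondecreasing there. *)
Lemma legp_ge l x : 0 <= x <= 1 -> 1 - (legp l).[x] <= lam l * (1 - x).
Proof.
move=> /andP[x0 x1].
pose q : {poly R} := sg R * (legp l)^`() + (lam l)%:P * 'X.
have dq : q^`() = (lam l)%:P * (1 - legp l).
  rewrite /q derivD derivM derivM derivC derivX mul0r add0r mulr1 legp_ode.
  rewrite /sg derivB derivC derivXn /= expr1 sub0r -mulr_natl polyC_natr; ring.
have qle z : 0 <= z <= 1 -> (1 - z ^+ 2) * (legp l)^`().[z] <= lam l * (1 - z).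
  move=> /andP[z0 z1].
  have : q.[z] <= q.[1].
    apply: (@poly_ndecr _ 0 1) => // w /andP[w0 w1].
    rewrite dq !hE.
    apply: mulr_ge0; first exact: lam_ge0.
    rewrite subr_ge0. apply: legp_le1; apply/andP; split; lra.
  by rewrite /q /sg !hE expr1n subrr mul0r add0r; nra.
have : ((lam l)%:P * 'X - legp l).[x] <= ((lam l)%:P * 'X - legp l).[1].
  apply: (@poly_ndecr _ 0 1) => // z /andP[z0 z1].
  rewrite derivB derivM derivC derivX mul0r add0r mulr1 !hE subr_ge0.
  have := qle z; rewrite (ltW z0) (ltW z1) => /(_ isT) h.
  have {}h : (1 + z) * (legp l)^`().[z] <= lam l.
    rewrite -(@ler_pM2l _ (1 - z)) ?subr_gt0 //.
    apply: le_trans (le_trans h _); first by rewrite le_eqVlt; apply/orP; left; apply/eqP; ring.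
    by rewrite mulrC.
  have [p0|/ltW p0] := leP 0 ((legp l)^`().[z]); first by nra.
  exact: le_trans p0 (lam_ge0 l).
by rewrite !hE legp1; nra.
Qed.

(* [legN l / sg] is nonnegative and, by [legN_deriv], has derivative
   [(2 lam + 4/sg) X P^2 / sg]: this controls the integral of [X P^2 / sg]. *)
Definition legN l : {poly R} :=
  sg R ^+ 2 * (legp l)^`() ^+ 2 + (lam l)%:P * sg R * legp l ^+ 2
  - 2%:P * 'X * sg R * legp l * (legp l)^`() + (1 + 'X ^+ 2) * legp l ^+ 2.

Lemma legN_deriv l :
  sg R * (legN l)^`() + 2%:P * 'X * legN l
  = 2%:P * 'X * ((lam l)%:P * sg R + 2%:P) * legp l ^+ 2.
Proof.
rewrite /legN; have := legp_ode l; have : ((lam l)%:P)^`() = 0 by rewrite derivC.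
move: (legp l) (lam l)%:P => p L dL ode.
have dsg : (sg R)^`() = - (2%:P * 'X).
  by rewrite /sg derivB derivC derivXn /= expr1 sub0r -mulr_natl polyC_natr.
have sE : sg R = 1 - 'X * 'X by rewrite /sg expr2.
move: (sg R) sE dsg ode => s sE ds ode.
rewrite !expr2 !(derivD, derivB, derivN, derivM, derivC, derivX) ds.
move: (p^`()^`()) ode => p2 ode; move: (p^`()) ode => p1 ode.
(* The Legendre equation is added with the coefficient under which [s * p2] occurs in [s] times the
   derivative of [legN], so the second derivative drops out. *)
transitivity (2%:P * 'X * (L * s + 2%:P) * (p * p) +
  (2%:P * s * s * p1 - 2%:P * 'X * s * p) * (s * p2 - (2%:P * 'X * p1 - L * p)));
  last by rewrite ode subrr mulr0 addr0.
by rewrite sE dL !polyC_natr; ring.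
Qed.

Lemma horner_legN_deriv l x :
  (sg R).[x] * (legN l)^`().[x] + 2 * x * (legN l).[x]
  = 2 * x * (lam l * (sg R).[x] + 2) * (legp l).[x] ^+ 2.
Proof.
have := congr1 (horner^~ x) (legN_deriv l).
by move: (legN l) (sg R) (legp l) => N s p; rewrite !hE.
Qed.

Lemma legN_ge0 l x : -1 <= x <= 1 -> 0 <= (legN l).[x].
Proof.
move=> x1; rewrite /legN /sg !hE.
have L0 := lam_ge0 l; move: (legp l)^`().[x] (legp l).[x] => p1 p.
have s0 : 0 <= 1 - x ^+ 2 by nra.
have -> : (1 - x ^+ 2) ^+ 2 * p1 ^+ 2 + lam l * (1 - x ^+ 2) * p ^+ 2 -
  2 * x * (1 - x ^+ 2) * p * p1 + (1 + x ^+ 2) * p ^+ 2 =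
  ((1 - x ^+ 2) * p1 - x * p) ^+ 2 + lam l * (1 - x ^+ 2) * p ^+ 2 + p ^+ 2 by ring.
by rewrite !addr_ge0 ?sqr_ge0 // mulr_ge0 ?sqr_ge0 ?mulr_ge0.
Qed.

(** The square in [h2] absorbs the cross term at the price of one more (1 - x^2)^2 P'^2. The energy
    bound times 1 - x^2 then yields 2 lam (1 - x^2), and the 3 bounds (1 + 2 x^2) P^2. *)
Lemma legN_le l x : -1 <= x <= 1 -> (legN l).[x] <= 2 * lam l * (1 - x ^+ 2) + 3.
Proof.
move=> x1; have p1 := legp_sqr_le1 l x1; have e1 := legp_energy_le l x1.
rewrite /legN /sg !hE.
have L0 := lam_ge0 l; move: (legp l)^`().[x] (legp l).[x] p1 e1 => d p p1 e1.
have s0 : 0 <= 1 - x ^+ 2 by nra.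
have x2 : x ^+ 2 <= 1 by nra.
have h := ler_wpM2l s0 e1.
have h2 := sqr_ge0 (x * p + (1 - x ^+ 2) * d).
have h3 : (1 + 2 * x ^+ 2) * p ^+ 2 <= 3.
  have q0 := sqr_ge0 p.
  by apply: le_trans (ler_wpM2l _ p1) _; [have := sqr_ge0 x; lra|lra].
have h4 : (1 - x ^+ 2) ^+ 2 * d ^+ 2 <= lam l * (1 - x ^+ 2).
  have : 0 <= lam l * p ^+ 2 * (1 - x ^+ 2) by apply: mulr_ge0 => //; apply: mulr_ge0 => //; exact: sqr_ge0.
  by move: h; nra.
by lra.
Qed.
End LegendrePoly.

(** * The variable b = tan(theta/2), in which db/b is -dx / (1 - x^2) for x = cos theta *)

Section HalfTangent.
Local Open Scope classical_set_scope.
Variable R : realType.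
Local Notation mu := (@lebesgue_measure R).

(** Immediate from the definition by a supremum over simple functions below. It allows integrands in
    [a] to be compared without establishing their measurability. *)
Lemma le_integral_ge0 d (T : measurableType d) (m : {measure set T -> \bar R}) (D : set T)
    (f g : T -> \bar R) :
  (forall x, D x -> (0 <= f x)%E) -> (forall x, D x -> (f x <= g x)%E) ->
  (\int[m]_(x in D) f x <= \int[m]_(x in D) g x)%E.
Proof.
move=> f0 fg; rewrite (integral_mkcond D f) (integral_mkcond D g).
rewrite !ge0_integralTE; last 2 first.
- by apply: erestrict_ge0 => x Dx; apply: le_trans (f0 x Dx) (fg x Dx).
- exact: erestrict_ge0.
apply: ub_ereal_sup => _ [h hf <-]; apply: ereal_sup_ubound.
by exists h => // x; apply: le_trans (hf x) _; apply: lee_restrict.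
Qed.

Definition posR : set R := [set a | 0 < a].

Lemma measurable_posR : measurable posR.
Proof.
rewrite (_ : posR = `]0, +oo[%classic) //.
by apply/seteqP; split => x /=; rewrite in_itv /= andbT.
Qed.

(* [cos theta] in terms of [b = tan (theta / 2)] *)
Definition xb (b : R) : R := (1 - b ^+ 2) / (1 + b ^+ 2).

Lemma one_sqr_gt0 (b : R) : 0 < 1 + b ^+ 2.
Proof. by have := sqr_ge0 b; lra. Qed.

Lemma one_sqr_neq0 (b : R) : 1 + b ^+ 2 != 0.
Proof. by rewrite lt0r_neq0 // one_sqr_gt0. Qed.

Lemma xbE (b : R) : xb b = 2 * (1 + b ^+ 2)^-1 - 1.
Proof. by rewrite /xb; field; exact: one_sqr_neq0. Qed.

Lemma sqr_xb (b : R) : 1 - xb b ^+ 2 = 4 * b ^+ 2 / (1 + b ^+ 2) ^+ 2.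
Proof. by rewrite /xb; field; exact: one_sqr_neq0. Qed.

Lemma xb_bound (b : R) : -1 <= xb b <= 1.
Proof.
by rewrite /xb ler_pdivlMr ?ler_pdivrMr ?one_sqr_gt0 //; have := sqr_ge0 b => h; apply/andP; split; lra.
Qed.

Lemma xb0 : xb 0 = 1. Proof. by rewrite /xb expr0n /= subr0 addr0 divr1. Qed.

Lemma is_derive_xb (b : R) : is_derive b 1 xb (- (4 * b / (1 + b ^+ 2) ^+ 2)).
Proof.
rewrite (_ : xb = (fun b => 2 * (1 + b ^+ 2)^-1 - 1)); last by apply/funext => c; exact: xbE.
have h : (fun b : R => 1 + b ^+ 2) b != 0 by exact: one_sqr_neq0.
have h1 : is_derive b 1 (fun b : R => 1 + b ^+ 2) (2 * b).
  by apply: is_derive_eq; rewrite /GRing.scale /=; ring.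
have h2 := @is_deriveV R (fun b : R => 1 + b ^+ 2) b _ _ h h1.
have h3 : is_derive b 1 (fun b => 2 * (1 + b ^+ 2)^-1 - 1) (2 * (- (1 + b ^+ 2) ^- 2 *: (2 * b)) - 0).
  by apply: is_deriveB.
apply: is_derive_eq; rewrite /GRing.scale /=; field; exact: one_sqr_neq0.
Qed.

Lemma derivable_continuous (f : R -> R) : (forall x, derivable f x 1) -> continuous f.
Proof. by move=> df x; apply: differentiable_continuous; apply/derivable1_diffP. Qed.

Lemma continuous_xb : continuous xb.
Proof. by apply: derivable_continuous => x; have := is_derive_xb x; case. Qed.

Lemma is_derive_poly_xb (p : {poly R}) (b : R) :
  is_derive b 1 (fun b => p.[xb b]) (- (p^`().[xb b] * (4 * b / (1 + b ^+ 2) ^+ 2))).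
Proof.
have h := @is_derive1_comp R (horner p) xb b _ _ (is_derive_poly p (xb b)) (is_derive_xb b).
by apply: is_derive_eq; rewrite /GRing.scale /= mulrN.
Qed.

Lemma continuous_poly_xb (p : {poly R}) : continuous (fun b => p.[xb b]).
Proof. by apply: derivable_continuous => x; have := is_derive_poly_xb p x; case. Qed.

Lemma continuous_one_sqr2 : continuous (fun b : R => (1 + b ^+ 2) ^+ 2).
Proof.
rewrite (_ : (fun _ => _) = horner ((1 + 'X ^+ 2) ^+ 2)); first exact: continuous_horner.
by apply/funext => b; rewrite horner_exp hornerD hornerXn hornerC.
Qed.

Lemma cvg_xb_pinfty : xb b @[b --> +oo] --> (-1 : R).
Proof.
rewrite (_ : xb = (fun b => 2 * (1 + b ^+ 2)^-1 - 1)); last by apply/funext => c; exact: xbE.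
rewrite -[X in _ --> X]add0r -[X in X - 1](mulr0 2).
apply: cvgB; last exact: cvg_cst.
apply: cvgM; first exact: cvg_cst.
apply/gtr0_cvgV0; first by near=> b; exact: one_sqr_gt0.
apply/cvgryPge => A; near=> b.
have : A <= b by near: b; apply: nbhs_pinfty_ge; rewrite num_real.
have : 1 <= b by near: b; apply: nbhs_pinfty_ge; rewrite num_real.
by nra.
Unshelve. all: by end_near. Qed.

(** Substitution x = [xb b], which decreases from 1 at b = 0 to the limit -1 at infinity: minus H
    composed with [xb] is a primitive of the integrand. *)
Lemma integral_poly_xb_le (H : {poly R}) : (forall x, -1 <= x <= 1 -> 0 <= H^`().[x]) ->
  (\int[mu]_(b in posR) (H^`().[xb b] * (4 * b / (1 + b ^+ 2) ^+ 2))%:E <= (H.[1] - H.[-1])%:E)%E.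
Proof.
move=> H0.
pose f (b : R) := H^`().[xb b] * (4 * b / (1 + b ^+ 2) ^+ 2).
have f0 b : 0 <= b -> 0 <= f b.
  move=> b0; apply: mulr_ge0; first exact/H0/xb_bound.
  by apply: divr_ge0; [exact: mulr_ge0|exact: sqr_ge0].
have cf : continuous f.
  move=> b; apply: cvgM; first exact: continuous_poly_xb.
  apply: cvgM; first by apply: cvgM; [exact: cvg_cst|exact: cvg_id].
  apply: cvgV; first by rewrite expf_neq0 // one_sqr_neq0.
  exact: continuous_one_sqr2.
have -> : (H.[1] - H.[-1])%:E = ((- H.[-1])%:E - (- H.[xb 0])%:E)%E.
  by rewrite xb0 -EFinB; congr EFin; ring.
rewrite -(@ge0_continuous_FTC2y R f (fun b => - H.[xb b]) 0 (- H.[-1])) //.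
- apply: ge0_subset_integral => //; first exact: measurable_posR.
  + apply/measurable_EFinP; exact: measurable_funTS (continuous_measurable_fun cf).
  + move=> b b0; rewrite lee_fin; apply: (f0 b).
    by move: b0; rewrite /= in_itv /= andbT.
  + by move=> b /= b0; rewrite in_itv /= andbT ltW.
- exact: continuous_subspaceT.
- apply: cvgN; apply: (@cvg_comp _ _ _ xb (horner H) _ (nbhs (-1 : R))).
    exact: cvg_xb_pinfty.
  exact: continuous_horner.
- by move=> b b0; have := is_deriveN (is_derive_poly_xb H b); case.
- apply: cvg_at_right_filter; apply: cvgN; exact: continuous_poly_xb.
- move=> b _; rewrite derive1E; have h := is_deriveN (is_derive_poly_xb H b).
  by rewrite derive_val opprK.
Qed.

Lemma integral_derive_itv (f F : R -> R) (a b : R) : a < b ->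
  (forall x, a <= x <= b -> is_derive x 1 F (f x)) ->
  {within `[a, b], continuous f} ->
  (\int[mu]_(x in `[a, b]) (f x)%:E = (F b - F a)%:E)%E.
Proof.
move=> ab dF cf; rewrite EFinB; apply: continuous_FTC2 => //.
- have cF x : a <= x <= b -> F y @[y --> x] --> F x.
    move=> xab; apply: differentiable_continuous; apply/derivable1_diffP.
    by have := dF x xab; case.
  split.
  + by move=> x; rewrite in_itv /= => /andP[/ltW ax /ltW xb]; have := dF x; rewrite ax xb => /(_ isT); case.
  + by apply: cvg_at_right_filter; apply: cF; rewrite lexx ltW.
  + by apply: cvg_at_left_filter; apply: cF; rewrite lexx ltW.
- move=> x; rewrite in_itv /= => /andP[/ltW ax /ltW xb].
  by rewrite derive1E; have := dF x; rewrite ax xb => /(_ isT) h; rewrite derive_val.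
Qed.

Lemma sg_xb (b : R) : (sg R).[xb b] = 1 - xb b ^+ 2.
Proof. by rewrite /sg hornerD hornerN hornerXn hornerC. Qed.

Lemma sg_xb_gt0 (b : R) : 0 < b -> 0 < (sg R).[xb b].
Proof.
move=> b0; rewrite sg_xb sqr_xb divr_gt0 ?exprn_gt0 ?one_sqr_gt0 //.
by rewrite mulr_gt0 // exprn_gt0.
Qed.

(** The derivative in b of minus [legN / sg] at [xb b], since dx/db = - sg / b. It equals 2 x P^2
    (lam + 2 / sg) / b and thus dominates x P^2 / b with the large factor 2 (lam + 2). *)
Definition legA' l (b : R) : R :=
  2 * xb b * (lam R l * (sg R).[xb b] + 2) * (legp R l).[xb b] ^+ 2 / ((sg R).[xb b] * b).

Lemma is_derive_legA l (b : R) : 0 < b ->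
  is_derive b 1 (fun b => - ((legN R l).[xb b] * ((sg R).[xb b])^-1)) (legA' l b).
Proof.
move=> b0; have s0 := lt0r_neq0 (sg_xb_gt0 b0).
have h1 := is_derive_poly_xb (legN R l) b.
have h2 := is_derive_poly_xb (sg R) b.
have h3 := @is_deriveV R (fun b => (sg R).[xb b]) b _ _ s0 h2.
have h4 := is_deriveN (is_deriveM h1 h3).
apply: is_derive_eq; rewrite /legA' /GRing.scale /=.
have E := horner_legN_deriv l (xb b).
have dsg : (sg R)^`().[xb b] = - (2 * xb b).
  by rewrite /sg derivB derivC derivXn /= expr1 sub0r hornerN hornerMn hornerX mulr_natl.
rewrite dsg; have sE : (sg R).[xb b] = 4 * b ^+ 2 / (1 + b ^+ 2) ^+ 2 by rewrite sg_xb sqr_xb.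
have w : 4 * b / (1 + b ^+ 2) ^+ 2 = (sg R).[xb b] / b.
  by rewrite sE; field; rewrite one_sqr_neq0 lt0r_neq0.
rewrite w -E {E w h1 h2 h3 h4 dsg sE}.
move: ((sg R).[xb b]) s0 ((legN R l)^`().[xb b]) => s s0 N'.
by field; rewrite s0 lt0r_neq0.
Qed.

Lemma continuous_legA' l (b : R) : 0 < b -> {for b, continuous (legA' l)}.
Proof.
move=> b0; rewrite /continuous_at /legA'; apply: cvgM.
  apply: cvgM; last by apply: cvgM; exact: continuous_poly_xb.
  apply: cvgM; first by apply: cvgM; [exact: cvg_cst|exact: continuous_xb].
  apply: cvgD; last exact: cvg_cst.
  by apply: cvgM; [exact: cvg_cst|exact: continuous_poly_xb].
apply: cvgV; first by rewrite mulf_neq0 ?lt0r_neq0 // sg_xb_gt0.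
by apply: cvgM; [exact: continuous_poly_xb|exact: cvg_id].
Qed.

(** Boundary values of [legN / sg]: the one at b = 1 enters with a minus sign and is nonnegative,
    the one at [be] is bounded by [legN_le]. *)
Lemma integral_legA_le l (be : R) : 0 < be < 1 ->
  (\int[mu]_(b in `[be, 1%R]) (legA' l b)%:E <=
     (2 * lam R l + 3 / (sg R).[xb be])%:E)%E.
Proof.
move=> /andP[be0 be1].
have dF x : be <= x <= 1 ->
    is_derive x 1 (fun b => - ((legN R l).[xb b] * ((sg R).[xb b])^-1)) (legA' l x).
  by move=> /andP[bx _]; apply: is_derive_legA; exact: lt_le_trans bx.
have cF : {within `[be, 1], continuous (legA' l)}.
  apply: continuous_in_subspaceT => b; rewrite inE /= in_itv /= => /andP[bb _].
  exact: continuous_legA' (lt_le_trans be0 bb).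
have -> := integral_derive_itv be1 dF cF.
rewrite lee_fin.
have s1 := sg_xb_gt0 (@ltr01 R); have sb := sg_xb_gt0 be0.
have h1 : 0 <= (legN R l).[xb 1] / (sg R).[xb 1].
  by rewrite divr_ge0 ?(ltW s1) // legN_ge0 // xb_bound.
have h2 : (legN R l).[xb be] / (sg R).[xb be] <= 2 * lam R l + 3 / (sg R).[xb be].
  rewrite ler_pdivrMr // mulrDl divfK ?lt0r_neq0 // sg_xb.
  exact: (legN_le l (xb_bound be)).
by lra.
Qed.

Lemma sqr_powR_half (s : R) k : 0 < s -> powR s (k%:R / 2) ^+ 2 = s ^+ k.
Proof.
move=> s0; rewrite -powR_mulrn ?powR_ge0 // -powRrM divfK ?pnatr_eq0 //.
by rewrite powR_mulrn // ltW.
Qed.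

(** The modulus of Y_l^m depends only on |m|. For m < 0, [rodr_neg] turns the derivative of order l
    - k into the one of order l + k, which flips the exponent of 1 - x^2 and exchanges the two
    factorials. *)
Lemma Ynorm_legendreP_sqr l (m : int) k x : absz m = k -> (k <= l)%N -> 0 < 1 - x ^+ 2 ->
  (Ynorm R l m * legendreP l m x) ^+ 2 =
  (2 * l + 1)%:R / (4 * pi) * ((l - k)`!%:R / (l + k)`!%:R) / (2 ^+ l * l`!%:R) ^+ 2
   * ((sg R).[x] ^+ k * (rodr R l (l + k)).[x] ^+ 2).
Proof.
move=> mk kl s0.
have f0 n : n`!%:R != 0 :> R by rewrite pnatr_eq0 -lt0n fact_gt0.
have sE : (sg R).[x] = 1 - x ^+ 2 by rewrite /sg hornerD hornerN hornerXn hornerC.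
have a0 : 2 ^+ l != 0 :> R by rewrite expf_neq0.
have p0 : pi != 0 :> R by rewrite lt0r_neq0 // pi_gt0.
have N1 : ((-1 : R) ^ m) ^+ 2 = 1.
  by case: m {mk} => n; rewrite ?NegzE -?exprnN -?exprnP ?exprVn -exprM mulnC exprM sqrrN !expr1n ?invr1.
rewrite /Ynorm /legendreP !exprMn sqr_sqrtr; last first.
  by rewrite !mulr_ge0 ?invr_ge0 ?mulr_ge0 ?pi_ge0.
have rE n : derivn n (('X ^+ 2 - 1) ^+ l : {poly R}) = rodr R l n by [].
rewrite N1 mul1r rE sE.
case: m mk {N1} => [n|n] /= nk.
  rewrite -nk in kl *.
  have -> : absz (l%:Z - n%:Z) = (l - n)%N by lia.
  rewrite -[n%:~R]/(n%:R) sqr_powR_half //.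
  move: ((l + n)`!%:R) (f0 (l + n)%N) ((l - n)`!%:R) ((2 * l + 1)%:R) pi p0 => N FN M L p p0.
  move: (2 ^+ l) a0 (l`!%:R) (f0 l) => a a0 b b0.
  by field; rewrite ?FN ?p0 ?a0 ?b0.
rewrite nk.
have -> : absz (l%:Z + Negz n) = (l - k)%N by lia.
have -> : (Negz n)%:~R / 2 = - (k%:R / 2) :> R.
  by rewrite -nk NegzE mulrNz mulNr.
rewrite powRN [(powR _ _)^-1 ^+ 2]exprVn sqr_powR_half //.
have : (rodr R l (l - k)).[x] = (l - k)`!%:R / (l + k)`!%:R * ((x ^+ 2 - 1) ^+ k * (rodr R l (l + k)).[x]).
  have := congr1 (horner^~ x) (rodr_neg R kl); rewrite !hornerZ hornerM horner_exp.
  rewrite hornerD hornerN hornerXn hornerC => h.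
  by apply: (mulfI (f0 (l + k)%N)); rewrite h; field; exact: f0.
move=> ->; have -> : (x ^+ 2 - 1) ^+ k = (-1) ^+ k * (1 - x ^+ 2) ^+ k.
  by rewrite -exprMn mulN1r opprB.
have s1 : (1 - x ^+ 2) ^+ k != 0 by rewrite expf_neq0 // lt0r_neq0.
have n1 : ((-1 : R) ^+ k) ^+ 2 = 1 by rewrite exprAC sqrrN !expr1n.
rewrite !exprMn n1 mul1r.
move: ((1 - x ^+ 2) ^+ k) s1 => S S0.
move: ((l + k)`!%:R) ((l - k)`!%:R) (f0 (l + k)%N) (f0 (l - k)%N) ((2 * l + 1)%:R) pi p0.
move=> N M FN FM L p p0.
move: (2 ^+ l) a0 (l`!%:R) (f0 l) => a a0 b b0.
by field; rewrite ?FN ?FM ?p0 ?S0 ?a0 ?b0.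
Qed.

(* [Y_l^m] in the variable [b = tan (theta / 2)], with the factor left by [sin theta = 2 b / (1 + b^2)]. *)
Definition Qm l (m : int) (b : R) : R := Ynorm R l m * legendreP l m (xb b) / (1 + b ^+ 2).

(** The factor (1 + b^2)^(-2) is bounded by 1, and db/b removes one power of [sg]; this requires |m|
    >= 1 and leaves the integrand of [sg_rodr_primitive]. *)
Lemma integral_Qm_le l (m : int) : (0 < absz m <= l)%N ->
  (\int[mu]_(b in posR) (Qm l m b ^+ 2 / b)%:E <= ((2 * l + 1)%:R)%:E)%E.
Proof.
move=> /andP[]; case E : (absz m) => [//|k] _ kl.
have [H dH HB] := sg_rodr_primitive R k (l - k.+1).
rewrite subnK // in dH HB.
set C := (2 * l + 1)%:R / (4 * pi) * ((l - k.+1)`!%:R / (l + k.+1)`!%:R) / (2 ^+ l * l`!%:R) ^+ 2 : R.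
have C0 : 0 <= C by rewrite !(mulr_ge0, invr_ge0, exprn_ge0, pi_ge0).
have H0 x : -1 <= x <= 1 -> 0 <= (C *: H)^`().[x].
  move=> x1; rewrite derivZ hornerZ dH hornerM !horner_exp /sg hornerD hornerN hornerXn hornerC.
  by apply: mulr_ge0 => //; apply: mulr_ge0; [apply: exprn_ge0; nra|exact: sqr_ge0].
apply: le_trans (le_trans (integral_poly_xb_le H0) _).
- apply: le_integral_ge0 => b /= b0; rewrite lee_fin.
    by apply: divr_ge0; [exact: sqr_ge0|exact: ltW].
  have s0 := sg_xb_gt0 b0.
  rewrite /Qm expr_div_n (@Ynorm_legendreP_sqr _ _ k.+1) //; last by rewrite -sg_xb.
  rewrite derivZ hornerZ dH hornerM !horner_exp -/C.
  have -> : 4 * b / (1 + b ^+ 2) ^+ 2 = (sg R).[xb b] / b.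
    by rewrite sg_xb sqr_xb; field; rewrite one_sqr_neq0 lt0r_neq0.
  have -> : C * ((sg R).[xb b] ^+ k * (rodr R l (l + k.+1)).[xb b] ^+ 2) * ((sg R).[xb b] / b)
     = C * ((sg R).[xb b] ^+ k.+1 * (rodr R l (l + k.+1)).[xb b] ^+ 2) / b.
    have h (c s t y : R) : c * (s ^+ k * y) * (s * t) = c * (s ^+ k.+1 * y) * t.
      by rewrite [s ^+ k.+1]exprS; ring.
    exact: h.
  rewrite ler_pM2r ?invr_gt0 // ler_pdivrMr ?exprn_gt0 ?one_sqr_gt0 //.
  rewrite ler_peMr //; last by rewrite exprn_ege1 // lerDl sqr_ge0.
  by rewrite mulr_ge0 // mulr_ge0 ?sqr_ge0 // exprn_ge0 // ltW.
- rewrite lee_fin !hornerZ -mulrBr.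
  apply: le_trans (ler_wpM2l C0 HB) _.
  have f0 n : n`!%:R != 0 :> R by rewrite pnatr_eq0 -lt0n fact_gt0.
  have t0 := two_fact_neq0 R l.
  (* The normalization of Y_l^m cancels all factorials, and only the factor 2l + 1 depends on l. *)
  have -> : C * (2 * (2 ^+ l * l`!%:R) ^+ 2 * (l + k.+1)`!%:R / (l - k.+1)`!%:R) = (2 * l + 1)%:R / (2 * pi).
    have p0 : pi != 0 :> R by rewrite lt0r_neq0 // pi_gt0.
    rewrite /C; move: ((2 * l + 1)%:R) ((l + k.+1)`!%:R) ((l - k.+1)`!%:R) (f0 (l + k.+1)%N) (f0 (l - k.+1)%N).
    move: (2 ^+ l * l`!%:R) t0 pi p0 => T T0 p p0 L N M FN FM.
    by field; rewrite ?FN ?FM ?p0 ?T0.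
  rewrite ler_pdivrMr ?mulr_gt0 ?pi_gt0 // ler_peMr //.
  by have := @pi_ge2 R; lra.
Qed.
End HalfTangent.

(** * The kernel of order m = 0, with its value 1 at b = 0 cut off *)

Section ZonalKernel.
Local Open Scope classical_set_scope.
Variable R : realType.
Local Notation mu := (@lebesgue_measure R).

Local Notation posR := (@posR R).

Lemma integral_restrict_le (D A : set R) (f : R -> \bar R) : (forall x, A x -> (0 <= f x)%E) ->
  (\int[mu]_(x in D) (f \_ A) x <= \int[mu]_(x in A) f x)%E.
Proof.
move=> f0; rewrite integral_mkcond [leRHS]integral_mkcond; apply: le_integral_ge0 => x _.
  by apply: erestrict_ge0 => y _; exact: erestrict_ge0.
by rewrite [leLHS]/patch; case: ifPn => // _; exact: erestrict_ge0.
Qed.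

Definition q0 l (b : R) : R := (legp R l).[xb b] / (1 + b ^+ 2).

Definition chi (be b : R) : R := (b < be)%R%:R.

(** For b <= 1 the point [xb b] lies in [0, 1], where [legp_ge] applies, and 1 - [xb b] <= 2 b^2. *)
Lemma q0_small l (b : R) : 0 < b <= 1 -> 0 <= 1 - q0 l b <= 2 * (lam R l + 2) * b ^+ 2.
Proof.
move=> /andP[b0 b1].
have x0 : 0 <= xb b <= 1.
  have /andP[_ ->] := xb_bound b; rewrite andbT /xb divr_ge0 ?(ltW (one_sqr_gt0 b)) //; nra.
have p1 := legp_le1 l (xb_bound b).
have p2 := legp_ge l x0.
have c0 := one_sqr_gt0 b.
have -> : 1 - q0 l b = (1 - (legp R l).[xb b] + b ^+ 2) / (1 + b ^+ 2).
  by rewrite /q0; field; exact: one_sqr_neq0.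
have b2 := sqr_ge0 b; have L0 := lam_ge0 R l.
apply/andP; split; first by rewrite divr_ge0 ?(ltW c0) //; lra.
have x1 : 1 - xb b <= 2 * b ^+ 2.
  have -> : 1 - xb b = 2 * b ^+ 2 / (1 + b ^+ 2) by rewrite /xb; field; exact: one_sqr_neq0.
  by rewrite ler_pdivrMr //; nra.
have : lam R l * (1 - xb b) <= lam R l * (2 * b ^+ 2) by rewrite ler_wpM2l.
move=> h; rewrite ler_pdivrMr //.
apply: (@le_trans _ _ (2 * (lam R l + 2) * b ^+ 2)); first by lra.
by apply: ler_peMr; [apply: mulr_ge0 => //; lra|rewrite lerDl].
Qed.

Lemma q0_chi_le l (be b : R) : 0 < be <= 1 -> 0 < b ->
  (q0 l b - chi be b) ^+ 2 / b <=
  (if b < be then 4 * (lam R l + 2) ^+ 2 * b ^+ 3 else 0)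
  + (if (be <= b <= 1) then legA' l b / (2 * (lam R l + 2)) else 0)
  + b / (1 + b ^+ 2) ^+ 2.
Proof.
move=> /andP[be0 be1] b0; have c0 := one_sqr_gt0 b; have L0 := lam_ge0 R l.
have B0 : 0 <= b / (1 + b ^+ 2) ^+ 2 by rewrite divr_ge0 ?sqr_ge0 // ltW.
have A0 : 0 <= b -> b <= 1 -> xb b * (legp R l).[xb b] ^+ 2 / b <= legA' l b / (2 * (lam R l + 2)).
  move=> _ b1; rewrite /legA'.
  have s0 := sg_xb_gt0 b0.
  have s1 : (sg R).[xb b] <= 1 by rewrite sg_xb lerBlDr lerDl sqr_ge0.
  have x0 : 0 <= xb b by rewrite /xb divr_ge0 ?(ltW c0) //; nra.
  have : 0 <= xb b * (legp R l).[xb b] ^+ 2 / b.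
    by apply: divr_ge0; [apply: mulr_ge0 => //; exact: sqr_ge0|exact: ltW].
  move: ((sg R).[xb b]) s0 s1 ((legp R l).[xb b]) (lam R l) L0 => s s0 s1 P L L0 h.
  (* The last quotient is at least 1 because [s <= 1]. *)
  have -> : 2 * xb b * (L * s + 2) * P ^+ 2 / (s * b) / (2 * (L + 2)) =
     (xb b * P ^+ 2 / b) * ((L * s + 2) / (s * (L + 2))).
    by field; rewrite !lt0r_neq0 //; lra.
  rewrite ler_peMr // ler_pdivlMr; last by apply: mulr_gt0 => //; lra.
  by nra.
have [bb|bb] := ltP b be; rewrite /chi ?bb.
  rewrite /= addr0 -[leLHS]addr0 lerD // ler_pdivrMr //.
  have /andP[h1 h2] : 0 <= 1 - q0 l b <= 2 * (lam R l + 2) * b ^+ 2.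
    by apply: q0_small => //; apply/andP; split => //; lra.
  rewrite -sqrrN opprB.
  have -> : 4 * (lam R l + 2) ^+ 2 * b ^+ 3 * b = (2 * (lam R l + 2) * b ^+ 2) ^+ 2 by ring.
  by rewrite ler_pXn2r // nnegrE // (le_trans h1).
rewrite (le_gtF bb) /= subr0 add0r.
have p1 := legp_sqr_le1 l (xb_bound b).
have [b1|b1] := leP b 1.
  apply: le_trans (lerD (A0 (ltW b0) b1) (lexx _)).
  (* This is (1 + b^2)^(-2) = [xb b] + b^4 / (1 + b^2)^2; the correction goes into the term for
     infinity. *)
  have -> : q0 l b ^+ 2 / b = xb b * (legp R l).[xb b] ^+ 2 / b
     + (legp R l).[xb b] ^+ 2 * b ^+ 2 * (b / (1 + b ^+ 2) ^+ 2).
    rewrite /q0 [in xb b * _]/xb; move: ((legp R l).[xb b]) => p.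
    by field; rewrite ?one_sqr_neq0 ?(lt0r_neq0 b0).
  rewrite lerD2l ler_piMl //.
  have : b ^+ 2 <= 1 by nra.
  by have := sqr_ge0 b; have := sqr_ge0 (legp R l).[xb b]; nra.
rewrite add0r /q0 expr_div_n mulrAC ler_pM2r ?invr_gt0 ?exprn_gt0 //.
rewrite ler_pdivrMr //; apply: le_trans p1 _; nra.
Qed.

Lemma integral_q0_le l : exists2 be : R, 0 < be &
  (\int[mu]_(b in posR) ((q0 l b - chi be b) ^+ 2 / b)%:E <= 4%:E)%E.
Proof.
pose La := lam R l + 2.
have La0 : 2 <= La by rewrite /La lerDr lam_ge0.
have Lp : 0 < La by lra.
(* With this cutoff La^2 be^4 = 1, and 3 / sg at [xb be] has the order of [La], like [lam]. The
   three pieces are then at most 1, 2 and 1 for every l. *)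
pose be : R := Num.sqrt La^-1.
have be2 : be ^+ 2 = La^-1 by rewrite sqr_sqrtr // invr_ge0 ltW.
have be0 : 0 < be by rewrite sqrtr_gt0 invr_gt0.
have be21 : be ^+ 2 <= 2^-1 by rewrite be2 lef_pV2 ?posrE //; lra.
have be1 : be < 1 by nra.
exists be => //.
pose f1 (b : R) := 4 * La ^+ 2 * b ^+ 3.
pose f2 (b : R) := legA' l b / (2 * La).
pose f3 (b : R) := b / (1 + b ^+ 2) ^+ 2.
pose A1 : set R := `[0, be]; pose A2 : set R := `[be, 1].
have f10 b : A1 b -> (0 <= (f1 b)%:E)%E.
  rewrite /A1 /= in_itv /= => /andP[b0 _]; rewrite lee_fin.
  by apply: mulr_ge0; [apply: mulr_ge0 => //; exact: sqr_ge0|exact: exprn_ge0].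
have f20 b : A2 b -> (0 <= (f2 b)%:E)%E.
  rewrite /A2 /= in_itv /= => /andP[bb b1]; rewrite lee_fin.
  have b0 := lt_le_trans be0 bb.
  rewrite /f2 divr_ge0 //; last by lra.
  rewrite /legA' divr_ge0 //; last by rewrite mulr_ge0 ?(ltW (sg_xb_gt0 b0)) // ltW.
  rewrite mulr_ge0 ?sqr_ge0 // mulr_ge0 //.
    by rewrite mulr_ge0 // /xb divr_ge0 ?(ltW (one_sqr_gt0 b)) //; nra.
  by rewrite addr_ge0 // mulr_ge0 ?(ltW (sg_xb_gt0 b0)).
have f30 b : posR b -> (0 <= (f3 b)%:E)%E.
  by move=> /ltW b0; rewrite lee_fin divr_ge0 ?sqr_ge0.
have mf1 : measurable_fun A1 f1.
  apply: measurable_funTS; apply: measurable_funM; first exact: measurable_cst.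
  by apply: measurable_funX; exact: measurable_id.
have mA : measurable_fun A2 (legA' l).
  have cA : {within A2, continuous (legA' l)}.
    apply: continuous_in_subspaceT => b; rewrite inE /A2 /= in_itv /= => /andP[bb _].
    exact: continuous_legA' (lt_le_trans be0 bb).
  by apply: (subspace_continuous_measurable_fun _ cA); exact: measurable_itv.
have mf2 : measurable_fun A2 f2.
  by apply: measurable_funM; last exact: measurable_cst.
have mf3 : measurable_fun posR f3.
  apply: measurable_funTS; apply: continuous_measurable_fun => b.
  apply: cvgM; first exact: cvg_id.
  by apply: cvgV; [rewrite expf_neq0 // one_sqr_neq0|exact: continuous_one_sqr2].
have I1 : (\int[mu]_(b in posR) (((EFin \o f1) \_ A1) b) <= 1%:E)%E.
  apply: le_trans (integral_restrict_le _ f10) _.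
  have dF x : 0 <= x <= be -> is_derive x 1 (fun b : R => La ^+ 2 * b ^+ 4) (f1 x).
    by move=> _; apply: is_derive_eq; rewrite /f1 /GRing.scale /=; ring.
  have cF : {within `[0, be], continuous f1}.
    apply: continuous_subspaceT.
    rewrite (_ : f1 = horner ((4 * La ^+ 2) *: 'X^3)); first exact: continuous_horner.
    by apply/funext => b; rewrite hornerZ hornerXn.
  have -> := integral_derive_itv be0 dF cF.
  by rewrite lee_fin expr0n /= mulr0 subr0 (exprM be 2 2) be2 exprVn mulfV // expf_neq0 // lt0r_neq0.
have I2 : (\int[mu]_(b in posR) (((EFin \o f2) \_ A2) b) <= 2%:E)%E.
  apply: le_trans (integral_restrict_le _ f20) _.
  have K0 : 0 < (2 * La)^-1 by rewrite invr_gt0; lra.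
  apply: (@le_trans _ _ ((2 * La)^-1%:E * \int[mu]_(b in A2) (legA' l b)%:E)%E).
    rewrite -ge0_integralZl_EFin ?(ltW K0) //.
    - by apply: le_integral_ge0 => b Ab; [exact: f20|rewrite -EFinM mulrC].
    - exact: measurable_itv.
    - by move=> b /f20; rewrite !lee_fin /f2 pmulr_lge0.
    - exact/measurable_EFinP.
  have bb : 0 < be < 1 by rewrite be0.
  apply: le_trans (lee_wpmul2l _ (integral_legA_le l bb)) _; first by rewrite lee_fin ltW.
  rewrite -EFinM lee_fin mulrC ler_pdivrMr; last by lra.
  have -> : 3 / (sg R).[xb be] = 3 * La * (1 + La^-1) ^+ 2 / 4.
    have n0 := lt0r_neq0 Lp.
    have n1 : La + 1 != 0 by rewrite lt0r_neq0 //; lra.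
    have n2 : 1 + La != 0 by rewrite addrC.
    by rewrite sg_xb sqr_xb be2; field; rewrite ?n0 ?n1 ?n2.
  have -> : 3 * La * (1 + La^-1) ^+ 2 / 4 = 3 / 4 * (La + 2 + La^-1).
    by field; rewrite lt0r_neq0.
  have : La^-1 <= 2^-1 by rewrite -be2.
  by move: La0; rewrite /La; lra.
have I3 : (\int[mu]_(b in posR) (f3 b)%:E <= 1%:E)%E.
  have h x : -1 <= x <= 1 -> 0 <= (4^-1 *: 'X : {poly R})^`().[x].
    by move=> _; rewrite derivZ derivX hornerZ hornerC; lra.
  apply: le_trans (le_trans (integral_poly_xb_le h) _).
    apply: le_integral_ge0 => // b b0.
    rewrite lee_fin derivZ derivX hornerZ hornerC /f3 mulr1 le_eqVlt; apply/orP; left.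
    by apply/eqP; field; exact: one_sqr_neq0.
  by rewrite !hornerZ !hornerX lee_fin; lra.
apply: (@le_trans _ _ (\int[mu]_(b in posR) (((EFin \o f1) \_ A1) b + ((EFin \o f2) \_ A2) b + (f3 b)%:E))%E).
  apply: le_integral_ge0 => b b0.
    by rewrite lee_fin divr_ge0 ?sqr_ge0 // ltW.
  have := @q0_chi_le l be b; rewrite be0 (ltW be1) => /(_ isT b0); rewrite -lee_fin => h.
  apply: le_trans h _; rewrite !EFinD; apply: leeD => //; apply: leeD.
  - rewrite /patch; case: ifPn => bb.
      by rewrite ifT // inE /A1 /= in_itv /= (ltW b0) ltW.
    by case: ifPn => //; rewrite inE => /f10.
  - rewrite /patch; case: ifPn => bb.
      by rewrite ifT // inE /A2 /= in_itv /=.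
    by case: ifPn => //; rewrite inE => /f20.
have m1 : measurable_fun posR ((EFin \o f1) \_ A1).
  by apply: measurable_funTS; apply/(measurable_restrictT _ _).1; [exact: measurable_itv|exact/measurable_EFinP].
have m2 : measurable_fun posR ((EFin \o f2) \_ A2).
  by apply: measurable_funTS; apply/(measurable_restrictT _ _).1; [exact: measurable_itv|exact/measurable_EFinP].
have g1 b : posR b -> (0 <= ((EFin \o f1) \_ A1) b)%E by move=> _; apply: erestrict_ge0.
have g2 b : posR b -> (0 <= ((EFin \o f2) \_ A2) b)%E by move=> _; apply: erestrict_ge0.
have mp := @measurable_posR R.
rewrite ge0_integralD //; last 3 first.
- by move=> b b0; apply: adde_ge0; [exact: g1|exact: g2].
- exact: emeasurable_funD.
- exact/measurable_EFinP.
rewrite ge0_integralD //.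
by apply: le_trans (leeD (leeD I1 I2) I3) _; rewrite -!EFinD lee_fin; lra.
Qed.
End ZonalKernel.

(** * Change of variables by an increasing diffeomorphism of the line *)

Lemma is_derive_gt0_lt (R : realType) (F g : R -> R) :
  (forall t : R, is_derive t 1 F (g t)) -> (forall t, 0 < g t) ->
  forall x y, (F x < F y) = (x < y).
Proof.
move=> dF g_gt0 x y.
have h a b : a < b -> F a < F b.
  move=> ab; apply: (@gtr0_derive1_incr R F a b) => //.
  - by move=> t _; rewrite derive1E; have h := dF t; rewrite derive_val.
  - apply: continuous_subspaceT; apply: derivable_continuous => t.
    by have := dF t; case.
have [/h //|/h/ltW yx|->] := ltgtP x y; last by rewrite ltxx.
by rewrite ltNge yx.
Qed.

Section ChangeOfVariables.
Local Open Scope classical_set_scope.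
Variable R : realType.
Local Notation mu := (@lebesgue_measure R).
Variables F g : R -> R.
Hypothesis dF : forall t : R, is_derive t 1 F (g t).
Hypothesis cg : continuous g.
Hypothesis g_gt0 : forall t, 0 < g t.
Hypothesis F_surj : forall y, exists t, F t = y.

Let cF : continuous F.
Proof. by apply: derivable_continuous => t; have := dF t; case. Qed.

Let mF : measurable_fun setT F. Proof. exact: continuous_measurable_fun. Qed.
Let mg : measurable_fun setT g. Proof. exact: continuous_measurable_fun. Qed.

Let F_lt x y : (F x < F y) = (x < y). Proof. exact: is_derive_gt0_lt. Qed.

Let F_le x y : (F x <= F y) = (x <= y). Proof. by rewrite !leNgt F_lt. Qed.

(** A measure that agrees with Lebesgue measure on the intervals ]a, b] by the fundamental theorem
    of calculus, hence on all measurable sets. This is the substitution rule for indicators; simple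
    functions and monotone limits follow. *)
Definition comp_density (A : set R) : \bar R := (\int[mu]_(t in F @^-1` A) (g t)%:E)%E.

Let comp_density0 : comp_density set0 = 0%E.
Proof. by rewrite /comp_density preimage_set0 integral_set0. Qed.

Let comp_density_ge0 A : (0 <= comp_density A)%E.
Proof. by apply: integral_ge0 => t _; rewrite lee_fin ltW. Qed.

Let measurable_pre A : measurable A -> measurable (F @^-1` A).
Proof. by move=> mA; rewrite -[X in measurable X]setTI; exact: mF. Qed.

Let comp_density_sigma : semi_sigma_additive (comp_density : set (measurableTypeR R) -> _).
Proof.
move=> /= A mA tA mUA; rewrite /comp_density preimage_bigcup.
rewrite ge0_integral_bigcup //=.
- apply: is_cvg_ereal_nneg_natsum_cond => n _ _.
  exact: comp_density_ge0.
- by move=> k; apply: measurable_pre; exact: mA.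
- by apply/measurable_EFinP; exact: measurable_funTS.
- by move=> t _; rewrite lee_fin ltW.
- apply/trivIsetP => i j _ _ ij; rewrite -preimage_setI.
  by move/trivIsetP: tA => /(_ i j I I ij) ->; rewrite preimage_set0.
Qed.

HB.instance Definition _ := isMeasure.Build _ _ _
  (comp_density : set (measurableTypeR R) -> \bar R) comp_density0 comp_density_ge0 comp_density_sigma.

Let comp_densityE A : measurable (A : set (measurableTypeR R)) -> mu A = comp_density A.
Proof.
move=> mA; apply: (@lebesgue_measure_unique R comp_density) => //.
move=> _ [[a b] _ <-] /=.
have [ab|ba] := ltP a b; last first.
  have e : `]a, b]%classic = set0 by rewrite set_itv_ge // bnd_simp -leNgt.
  by rewrite e measure0 comp_density0.
have [s sa] := F_surj a; have [t tb] := F_surj b.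
have st : s < t by rewrite -F_lt sa tb.
rewrite lebesgue_measure_itv /= lte_fin ab /comp_density.
have -> : F @^-1` `]a, b] = `]s, t].
  by apply/seteqP; split => x /=; rewrite !in_itv /= -sa -tb F_lt F_le.
rewrite integral_itv_obnd_cbnd; last by apply/measurable_EFinP; exact: measurable_funTS.
rewrite (integral_derive_itv st (fun x _ => dF x)) ?sa ?tb -?EFinB //.
exact: continuous_subspaceT.
Qed.

Import HBNNSimple.

Let integral_comp_nnsfun (h : {nnsfun (measurableTypeR R) >-> R}) :
  (\int[mu]_t (h (F t) * g t)%:E = \int[mu]_t (h t)%:E)%E.
Proof.
have mh y : measurable_fun setT (fun t => \1_(h @^-1` [set y]) (F t) : R).
  have hy : measurable (h @^-1` [set y] : set (measurableTypeR R)) by [].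
  have mi : measurable_fun setT (\1_(h @^-1` [set y]) : measurableTypeR R -> R).
    exact: measurable_indic.
  exact: (@measurableT_comp _ _ _ (measurableTypeR R) (measurableTypeR R) (measurableTypeR R) _ _ _ mi mF).
rewrite integralT_nnsfun sintegralE.
transitivity (\int[mu]_t (\sum_(y \in range h) (y * (\1_(h @^-1` [set y]) (F t) * g t))%:E))%E.
  apply: eq_integral => t _; rewrite {1}fimfunE !fsbig_finite //= sumEFin mulr_suml.
  by congr EFin; apply: eq_bigr => y _; rewrite mulrA.
rewrite ge0_integral_fsum //=; last 2 first.
- move=> y; apply/measurable_EFinP; apply: measurable_funM => //.
  apply: measurable_funM => //.
  exact: mh.
- move=> y t _; rewrite lee_fin indicE; case: (boolP (F t \in _)); rewrite ?mul0r ?mulr0 // inE /= => <-.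
  by rewrite mul1r mulr_ge0 // ltW.
apply: eq_fsbigr => y; rewrite inE => -[x _ xy].
have y0 : 0 <= y by rewrite -xy.
transitivity (\int[mu]_t (y%:E * (\1_(h @^-1` [set y]) (F t) * g t)%:E))%E.
  by apply: eq_integral => t _; rewrite EFinM.
rewrite ge0_integralZl_EFin //; last 2 first.
- by move=> t _; rewrite lee_fin mulr_ge0 // ltW.
- apply/measurable_EFinP; apply: measurable_funM => //.
  exact: mh.
congr (_ * _)%E; rewrite comp_densityE // /comp_density [RHS]integral_mkcond.
apply: eq_integral => t _; rewrite /patch indicE /=.
have -> : (t \in F @^-1` (h @^-1` [set y])) = (F t \in h @^-1` [set y]).
  by apply/idP/idP; rewrite !inE.
by case: (F t \in _); rewrite ?mul1r ?mul0r.
Qed.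

Lemma ge0_integral_comp_diffeo (f : R -> \bar R) : measurable_fun setT f ->
  (forall y, (0 <= f y)%E) -> (\int[mu]_t (f (F t) * (g t)%:E) = \int[mu]_y f y)%E.
Proof.
move=> mf f0; pose h := @nnsfun_approx _ (measurableTypeR R) R setT measurableT f mf.
have hf x : (h n x)%:E @[n --> \oo] --> f x by apply: cvg_nnsfun_approx.
have nd x m n : (m <= n)%N -> h m x <= h n x.
  by move=> mn; have /lefP := @nd_nnsfun_approx _ (measurableTypeR R) R setT measurableT f mf _ _ mn; exact.
transitivity (limn (fun n => \int[mu]_t (h n (F t) * g t)%:E))%E.
  rewrite -monotone_convergence //.
  - apply: eq_integral => t _; apply/esym/cvg_lim => //.
    under eq_fun do rewrite EFinM.
    by apply: cvgeZr => //; exact: hf.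
  - move=> n; apply/measurable_EFinP; apply: measurable_funM => //.
    have mi : measurable_fun setT (h n : measurableTypeR R -> R) by [].
    exact: (@measurableT_comp _ _ _ (measurableTypeR R) (measurableTypeR R) (measurableTypeR R) _ _ _ mi mF).
  - by move=> n t _; rewrite lee_fin mulr_ge0 // ltW.
  - by move=> t _ m n mn; rewrite lee_fin ler_wpM2r ?(ltW (g_gt0 t)) // nd.
under eq_fun do rewrite integral_comp_nnsfun.
rewrite -monotone_convergence //.
- by apply: eq_integral => t _; apply/cvg_lim.
- by move=> n; exact/measurable_EFinP.
- by move=> n t _; rewrite lee_fin.
- by move=> t _ m n mn; rewrite lee_fin nd.
Qed.

End ChangeOfVariables.

(** * Invariance of da/a, and the dilation as a substitution in the polar angle *)

Section Dilation.
Local Open Scope classical_set_scope.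
Variable R : realType.
Local Notation mu := (@lebesgue_measure R).
Local Notation posR := (@posR R).

Lemma measurable_inv_posR : measurable_fun posR (fun b : R => b^-1).
Proof.
apply: open_continuous_measurable_fun; first exact: open_gt.
by move=> b; rewrite inE /= => b0; apply: cvgV => //; rewrite lt0r_neq0.
Qed.

Lemma integral_scale_haar (f : R -> R) (s : R) : 0 < s -> measurable_fun setT f ->
  (forall x, 0 <= f x) ->
  (\int[mu]_(a in posR) (f (a * s) / a)%:E = \int[mu]_(b in posR) (f b / b)%:E)%E.
Proof.
move=> s0 mf f0; pose h := (fun b : R => (f b / b)%:E) \_ posR.
have mh : measurable_fun setT h.
  apply/(measurable_restrictT _ _).1; first exact: measurable_posR.
  apply/measurable_EFinP; apply: measurable_funM; first exact: measurable_funTS.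
  exact: measurable_inv_posR.
have h0 y : (0 <= h y)%E.
  by apply: erestrict_ge0 => b b0; rewrite lee_fin divr_ge0 // ltW.
rewrite [RHS]integral_mkcond [LHS]integral_mkcond -/h.
have dF (t : R) : is_derive t 1 (fun a => a * s) s.
  by apply: is_derive_eq; rewrite /GRing.scale /=; ring.
rewrite -(@ge0_integral_comp_diffeo R (fun a => a * s) (fun=> s) dF _ _ _ h) //; last 2 first.
- by move=> x; exact: cvg_cst.
- by move=> y; exists (y / s); rewrite divfK // lt0r_neq0.
apply: eq_integral => a _; rewrite /h /patch.
have -> : (a * s \in posR) = (a \in posR) by apply/idP/idP; rewrite !inE /posR /= pmulr_lgt0.
case: ifPn; rewrite ?mul0e // inE /posR /= => a0.
by rewrite -EFinM; congr EFin; field; rewrite !lt0r_neq0.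
Qed.

Variable a : R.
Hypothesis a0 : 0 < a.

(** A smooth extension of theta_{1/a} from (0, pi) to the whole line. It rewrites 2 atan(T / a), T =
    tan(t/2), as t plus a correction expressed by sine and cosine, which has no singularity at odd
    multiples of pi. *)
Definition Phi (t : R) : R :=
  t + 2 * atan ((1 - a) * (sin (t / 2) * cos (t / 2)) * (a * cos (t / 2) ^+ 2 + sin (t / 2) ^+ 2)^-1).

Definition dPhi (t : R) : R := a / (a ^+ 2 * cos (t / 2) ^+ 2 + sin (t / 2) ^+ 2).

Lemma conv_cos_sin_gt0 (c t : R) : 0 < c -> 0 < c * cos t ^+ 2 + sin t ^+ 2.
Proof.
move=> c0; have := cos2Dsin2 t; have := sqr_ge0 (cos t); have := sqr_ge0 (sin t).
move: (cos t ^+ 2) (sin t ^+ 2) => x y x0 y0 xy.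
have [x1|x1] := leP x 0; first by nra.
by have := mulr_gt0 c0 x1; lra.
Qed.

Lemma dPhi_gt0 t : 0 < dPhi t.
Proof. by rewrite divr_gt0 // conv_cos_sin_gt0 // exprn_gt0. Qed.

Lemma is_derive_Phi (t : R) : is_derive t 1 Phi (dPhi t).
Proof.
have hh : is_derive t 1 (fun t : R => t / 2) (2^-1).
  by apply: is_derive_eq; rewrite /GRing.scale /=; ring.
have hs : is_derive t 1 (fun t : R => sin (t / 2)) (cos (t / 2) / 2).
  exact: (@is_derive1_comp R sin (fun t : R => t / 2) t _ _ (is_derive_sin _) hh).
have hc : is_derive t 1 (fun t : R => cos (t / 2)) (- sin (t / 2) / 2).
  exact: (@is_derive1_comp R cos (fun t : R => t / 2) t _ _ (is_derive_cos _) hh).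
have D0 : a * cos (t / 2) ^+ 2 + sin (t / 2) ^+ 2 != 0 by rewrite lt0r_neq0 // conv_cos_sin_gt0.
have hD : is_derive t 1 (fun t : R => a * cos (t / 2) ^+ 2 + sin (t / 2) ^+ 2)
   ((1 - a) * (sin (t / 2) * cos (t / 2))).
  by apply: is_derive_eq; rewrite /GRing.scale /=; field.
have hV := @is_deriveV R (fun t : R => a * cos (t / 2) ^+ 2 + sin (t / 2) ^+ 2) t _ _ D0 hD.
have hr : is_derive t 1 (fun t : R => (1 - a) * (sin (t / 2) * cos (t / 2)) * (a * cos (t / 2) ^+ 2 + sin (t / 2) ^+ 2)^-1)
   (((1 - a) * (cos (t / 2) ^+ 2 - sin (t / 2) ^+ 2) / 2 * (a * cos (t / 2) ^+ 2 + sin (t / 2) ^+ 2)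
    - ((1 - a) * (sin (t / 2) * cos (t / 2))) ^+ 2) / (a * cos (t / 2) ^+ 2 + sin (t / 2) ^+ 2) ^+ 2).
  apply: is_derive_eq; rewrite /GRing.scale /=.
  move: (cos (t / 2)) (sin (t / 2)) D0 => c s D0.
  by field.
have ha := @is_derive1_comp R atan _ t _ _ (is_derive1_atan _) hr.
rewrite /Phi; apply: is_derive_eq; rewrite /dPhi /GRing.scale /=.
have D1 : a ^+ 2 * cos (t / 2) ^+ 2 + sin (t / 2) ^+ 2 != 0.
  by rewrite lt0r_neq0 // conv_cos_sin_gt0 // exprn_gt0.
have := cos2Dsin2 (t / 2); move: (cos (t / 2)) (sin (t / 2)) D0 D1 => c s D0 D1 cs.
(* With c^2 + s^2 = 1 inserted, this is (a c^2 + s^2)^2 + (1 - a)^2 s^2 c^2 = (a^2 c^2 + s^2)(c^2 +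
   s^2). *)
have E : 1 + ((1 - a) * (s * c) * (a * c ^+ 2 + s ^+ 2)^-1) ^+ 2
   = (a ^+ 2 * c ^+ 2 + s ^+ 2) / (a * c ^+ 2 + s ^+ 2) ^+ 2.
  have -> : a ^+ 2 * c ^+ 2 + s ^+ 2 = (a ^+ 2 * c ^+ 2 + s ^+ 2) * (c ^+ 2 + s ^+ 2) by rewrite cs mulr1.
  by field.
rewrite E.
have E2 : (1 - a) * (c ^+ 2 - s ^+ 2) / 2 * (a * c ^+ 2 + s ^+ 2) - ((1 - a) * (s * c)) ^+ 2
  = (1 - a) * (a * c ^+ 2 - s ^+ 2) / 2.
  have -> : (1 - a) * (a * c ^+ 2 - s ^+ 2) / 2 = (1 - a) * (a * c ^+ 2 - s ^+ 2) / 2 * (c ^+ 2 + s ^+ 2) by rewrite cs mulr1.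
  by field.
rewrite E2.
have E3 : a = a * (c ^+ 2 + s ^+ 2) by rewrite cs mulr1.
rewrite [RHS](_ : _ = a * (c ^+ 2 + s ^+ 2) / (a ^+ 2 * c ^+ 2 + s ^+ 2)); last by rewrite -E3.
have h (X D G : R) : D != 0 -> G != 0 -> 2 * ((G / D ^+ 2)^-1 * (X / 2 / D ^+ 2)) = X / G.
  by move=> D0' G0; field; rewrite D0' G0.
by rewrite h //; apply: (mulIf D1); rewrite mulrDl !divfK // mul1r; ring.
Qed.

Lemma continuous_dPhi : continuous dPhi.
Proof.
have ch : continuous (fun t : R => t / 2) by move=> t; apply: cvgM; [exact: cvg_id|exact: cvg_cst].
have cc : continuous (fun t : R => cos (t / 2)).
  by move=> t; apply: (@cvg_comp _ _ _ (fun t : R => t / 2) cos _ _ _ (ch t)); exact: continuous_cos.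
have cs : continuous (fun t : R => sin (t / 2)).
  by move=> t; apply: (@cvg_comp _ _ _ (fun t : R => t / 2) sin _ _ _ (ch t)); exact: continuous_sin.
move=> t; apply: cvgM; first exact: cvg_cst.
apply: cvgV; first by rewrite lt0r_neq0 // conv_cos_sin_gt0 // exprn_gt0.
apply: cvgD; last by apply: cvgM; exact: cs.
by apply: cvgM; [exact: cvg_cst|apply: cvgM; exact: cc].
Qed.

Lemma continuous_Phi : continuous Phi.
Proof. by apply: derivable_continuous => t; have := is_derive_Phi t; case. Qed.

Lemma Phi_surj y : exists t, Phi t = y.
Proof.
have p0 := @pi_gt0 R.
(* The arctangent is bounded by pi/2, so [Phi] stays within pi of the identity and the intermediate
   value theorem gives surjectivity. *)
have b t : t - pi <= Phi t <= t + pi.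
  rewrite /Phi; set r := _ * _^-1.
  have := atan_gtNpi2 r; have := atan_ltpi2 r; move: (atan r) => z z1 z2.
  by apply/andP; split; lra.
have [||c _ cy] := @IVT R Phi (y - pi) (y + pi) y _ (continuous_subspaceT continuous_Phi).
- by lra.
- have /andP[_ h1] := b (y - pi); have /andP[h2 _] := b (y + pi).
  by rewrite ge_min le_max; apply/andP; split; apply/orP; [left|right]; lra.
by exists c.
Qed.

Lemma Phi0 : Phi 0 = 0.
Proof. by rewrite /Phi mul0r sin0 mul0r mulr0 mul0r atan0 mulr0 addr0. Qed.

Lemma Phipi : Phi pi = pi.
Proof. by rewrite /Phi cos_pihalf mulr0 mulr0 mul0r atan0 mulr0 addr0. Qed.

Lemma Phi_itv t : (0 < Phi t < pi) = (0 < t < pi).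
Proof.
have h := is_derive_gt0_lt is_derive_Phi dPhi_gt0.
by rewrite -{1}Phi0 -{1}Phipi !h.
Qed.

(** The difference of the two sides has derivative zero and vanishes at T = 0. The denominator a +
    T^2 is positive, so the addition formula holds without a jump by pi. *)
Lemma atan_dilation (T : R) :
  atan (T / a) = atan T + atan ((1 - a) * T * (a + T ^+ 2)^-1).
Proof.
pose h (T : R) := atan (T / a) - atan T - atan ((1 - a) * T * (a + T ^+ 2)^-1).
have a1 := lt0r_neq0 a0.
suff : h T = h 0 by rewrite /h mul0r mulr0 mul0r atan0 !subr0 => /eqP; rewrite subr_eq0 subr_eq => /eqP ->; rewrite addrC.
apply: is_derive_0_is_cst; suff : forall x : R, is_derive x 1 h 0 by [].
move=> x.
have D0 : a + x ^+ 2 != 0 by rewrite lt0r_neq0 // ltr_wpDr // sqr_ge0.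
have hD : is_derive x 1 (fun x : R => a + x ^+ 2) (2 * x).
  by apply: is_derive_eq; rewrite /GRing.scale /=; ring.
have hV := @is_deriveV R (fun x : R => a + x ^+ 2) x _ _ D0 hD.
have hr : is_derive x 1 (fun x : R => (1 - a) * x * (a + x ^+ 2)^-1) ((1 - a) * (a - x ^+ 2) / (a + x ^+ 2) ^+ 2).
  by apply: is_derive_eq; rewrite /GRing.scale /=; field.
have h1 := @is_derive1_comp R atan _ x _ _ (is_derive1_atan _) hr.
have hq : is_derive x 1 (fun x : R => x / a) (a^-1).
  by apply: is_derive_eq; rewrite /GRing.scale /=; ring.
have h2 := @is_derive1_comp R atan _ x _ _ (is_derive1_atan _) hq.
rewrite /h; apply: is_derive_eq; rewrite /GRing.scale /=.
have n1 : a ^+ 2 + x ^+ 2 != 0 by rewrite lt0r_neq0 // ltr_wpDr ?sqr_ge0 // exprn_gt0.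
have n2 := one_sqr_neq0 x.
have -> : (1 + (x / a) ^+ 2)^-1 = a ^+ 2 / (a ^+ 2 + x ^+ 2) by field; rewrite a1 n1.
have -> : 1 + ((1 - a) * x * (a + x ^+ 2)^-1) ^+ 2
    = (a ^+ 2 + x ^+ 2) * (1 + x ^+ 2) / (a + x ^+ 2) ^+ 2 by field.
by field; rewrite a1 n1 n2 D0.
Qed.

Lemma cos_half_gt0 (t : R) : 0 < t < pi -> 0 < cos (t / 2).
Proof. by move=> /andP[t0 t1]; apply: cos_gt0_pihalf; apply/andP; split; lra. Qed.

Lemma sin_half_gt0 (t : R) : 0 < t < pi -> 0 < sin (t / 2).
Proof. by move=> /andP[t0 t1]; apply: sin_gt0_pi; apply/andP; split; lra. Qed.

Lemma tan_half_gt0 (t : R) : 0 < t < pi -> 0 < tan (t / 2).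
Proof. by move=> ht; rewrite /tan divr_gt0 ?sin_half_gt0 ?cos_half_gt0. Qed.

Lemma theta_aE (t : R) : 0 < t < pi -> theta_a a^-1 t = Phi t.
Proof.
move=> ht; have /andP[t0 t1] := ht; have c0 := cos_half_gt0 ht.
rewrite /theta_a (lt_eqF t1) mulrC [a^-1 * _]mulrC atan_dilation tanK; last by rewrite in_itv /=; apply/andP; split; lra.
rewrite /Phi mulrDl divfK //; congr (_ + _); rewrite [RHS]mulrC; congr (atan _ * _).
have n := lt0r_neq0 (conv_cos_sin_gt0 (t / 2) a0).
have n' : a + tan (t / 2) ^+ 2 != 0 by rewrite lt0r_neq0 // ltr_wpDr // sqr_ge0.
have n0 := lt0r_neq0 c0.
move: n'; rewrite /tan; move: (cos (t / 2)) (sin (t / 2)) n n0 => c s n n0 n'.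
have -> : a + (s / c) ^+ 2 = (a * c ^+ 2 + s ^+ 2) / c ^+ 2 by field.
by field; rewrite n n0.
Qed.

Lemma tan_half_Phi (t : R) : 0 < t < pi -> tan (t / 2) = a * tan (Phi t / 2).
Proof.
move=> ht; rewrite -theta_aE // /theta_a (lt_eqF (proj2 (andP ht))) [2 * _]mulrC mulfK // atanK.
by rewrite mulrA divff ?mul1r // lt0r_neq0.
Qed.

(** The weight in the definition of D_a is exactly the Jacobian of the substitution, so nothing of
    it remains after the change of variables. *)
Lemma sqrt_kappa t : Num.sqrt (kappa a t) = dPhi t.
Proof.
rewrite /kappa /dPhi.
have -> : cos t = cos (t / 2) ^+ 2 - sin (t / 2) ^+ 2.
  by rewrite [in LHS](_ : t = t / 2 + t / 2) ?cosD -?expr2 //; field.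
have n := conv_cos_sin_gt0 (t / 2) (exprn_gt0 2 a0).
have := cos2Dsin2 (t / 2); move: (cos (t / 2)) (sin (t / 2)) n => c s n cs.
have -> : (a ^+ 2 - 1) * (c ^+ 2 - s ^+ 2) + (a ^+ 2 + 1) = 2 * (a ^+ 2 * c ^+ 2 + s ^+ 2).
  transitivity ((a ^+ 2 - 1) * (c ^+ 2 - s ^+ 2) + (a ^+ 2 + 1) * (c ^+ 2 + s ^+ 2)).
    by rewrite cs mulr1.
  by ring.
have -> : 4 * a ^+ 2 / (2 * (a ^+ 2 * c ^+ 2 + s ^+ 2)) ^+ 2 = (a / (a ^+ 2 * c ^+ 2 + s ^+ 2)) ^+ 2.
  have h (D : R) : D != 0 -> 4 * a ^+ 2 / (2 * D) ^+ 2 = (a / D) ^+ 2 by move=> D0; field.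
  by apply: h; rewrite lt0r_neq0.
by rewrite sqrtr_sqr ger0_norm // divr_ge0 // ltW.
Qed.

Lemma cosE_tan (t : R) : 0 < t < pi -> cos t = xb (tan (t / 2)).
Proof.
move=> ht; have n0 := lt0r_neq0 (cos_half_gt0 ht).
have -> : cos t = cos (t / 2) ^+ 2 - sin (t / 2) ^+ 2.
  by rewrite [in LHS](_ : t = t / 2 + t / 2) ?cosD -?expr2 //; field.
have := cos2Dsin2 (t / 2); rewrite /xb /tan; move: (cos (t / 2)) (sin (t / 2)) n0 => c s n0 cs.
have -> : 1 + (s / c) ^+ 2 = (c ^+ 2 + s ^+ 2) / c ^+ 2 by field.
by rewrite cs; field.
Qed.

Lemma sinE_tan (t : R) : 0 < t < pi -> sin t = 2 * tan (t / 2) / (1 + tan (t / 2) ^+ 2).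
Proof.
move=> ht; have n0 := lt0r_neq0 (cos_half_gt0 ht).
have -> : sin t = 2 * sin (t / 2) * cos (t / 2).
  by rewrite [in LHS](_ : t = t / 2 + t / 2) ?sinD; [ring|field].
have := cos2Dsin2 (t / 2); rewrite /tan; move: (cos (t / 2)) (sin (t / 2)) n0 => c s n0 cs.
have -> : 1 + (s / c) ^+ 2 = (c ^+ 2 + s ^+ 2) / c ^+ 2 by field.
by rewrite cs; field.
Qed.

Lemma ge0_integral_Phi2 (f : R * R -> \bar R) : measurable_fun setT f ->
  (forall x, (0 <= f x)%E) ->
  (\int[@leb2 R]_x (f (Phi x.1, x.2) * (dPhi x.1)%:E) = \int[@leb2 R]_x f x)%E.
Proof.
move=> mf f0.
have mP : measurable_fun setT Phi by apply: continuous_measurable_fun; exact: continuous_Phi.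
have mdP : measurable_fun setT dPhi by apply: continuous_measurable_fun; exact: continuous_dPhi.
rewrite /leb2 !fubini_tonelli2 //=; last 2 first.
- apply: emeasurable_funM.
    apply: (measurableT_comp mf); apply: measurable_fun_pair.
      by apply: (measurableT_comp mP); exact: measurable_fst.
    exact: measurable_snd.
  by apply/measurable_EFinP; apply: (measurableT_comp mdP); exact: measurable_fst.
- by move=> x; rewrite mule_ge0 // lee_fin ltW // dPhi_gt0.
apply: eq_integral => y _; rewrite /fubini_G /=.
rewrite (@ge0_integral_comp_diffeo R Phi dPhi is_derive_Phi continuous_dPhi dPhi_gt0 Phi_surj (fun t => f (t, y))) //.
apply: (measurableT_comp mf); exact: measurable_pair2.
Qed.

(** The positive Jacobian commutes with positive and negative parts, so the identity holds between
    extended reals as such. *)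
Lemma integral_Phi2 (f : R * R -> R) : measurable_fun setT f ->
  (\int[@leb2 R]_x (f (Phi x.1, x.2) * dPhi x.1)%:E = \int[@leb2 R]_x (f x)%:E)%E.
Proof.
move=> mf; have maxM (x d : R) : 0 < d ->
    (Order.max (x * d)%:E 0 = Order.max x%:E 0 * d%:E)%E.
  move=> d0; have [x0|/ltW x0] := leP 0 x.
    by rewrite !max_l ?lee_fin ?mulr_ge0 ?(ltW d0).
  by rewrite !max_r ?lee_fin ?mul0e // mulr_le0_ge0 // ltW.
rewrite integralE [RHS]integralE; congr (_ - _)%E.
- rewrite -[RHS]ge0_integral_Phi2 //; last exact/measurable_funepos/measurable_EFinP.
  by apply: eq_integral => x _; rewrite !funeposE /= maxM // dPhi_gt0.
- rewrite -[RHS]ge0_integral_Phi2 //; last exact/measurable_funeneg/measurable_EFinP.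
  by apply: eq_integral => x _; rewrite !funenegE /= -mulNr maxM // dPhi_gt0.
Qed.
End Dilation.

(** * Bounded measurable functions on a set of finite measure *)

Section BoundedMeasurable.
Local Open Scope classical_set_scope.
Context d (T : measurableType d) (R : realType).
Implicit Types f g : T -> R.

(** A class closed under sums and products and integrable on every measurable set of finite measure,
    which settles the integrability conditions of linearity and Fubini at once. *)
Definition bmeas f := measurable_fun setT f /\ exists M, forall x, `|f x| <= M.

Lemma bmeas_cst (c : R) : bmeas (fun=> c).
Proof. by split; [exact: measurable_cst|exists `|c|]. Qed.

Lemma bmeasD f g : bmeas f -> bmeas g -> bmeas (fun x => f x + g x).
Proof.
move=> [mf [M fM]] [mg [N gN]]; split; first exact: measurable_funD.
by exists (M + N) => x; rewrite (le_trans (ler_normD _ _)) // lerD.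
Qed.

Lemma bmeasM f g : bmeas f -> bmeas g -> bmeas (fun x => f x * g x).
Proof.
move=> [mf [M fM]] [mg [N gN]]; split; first exact: measurable_funM.
by exists (M * N) => x; rewrite normrM ler_pM.
Qed.

Lemma bmeasZ (c : R) f : bmeas f -> bmeas (fun x => c * f x).
Proof. by move=> bf; apply: bmeasM => //; exact: bmeas_cst. Qed.

Lemma bmeasB f g : bmeas f -> bmeas g -> bmeas (fun x => f x - g x).
Proof.
move=> bf bg; rewrite (_ : (fun _ => _) = (fun x => f x + -1 * g x)).
  by apply: bmeasD => //; exact: bmeasZ.
by apply/funext => x; rewrite mulN1r.
Qed.

Lemma bmeasX f n : bmeas f -> bmeas (fun x => f x ^+ n).
Proof.
move=> bf; elim: n => [|n IH]; first exact: bmeas_cst.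
by under eq_fun do rewrite exprS; exact: bmeasM.
Qed.

Lemma bmeas_sum (I : Type) (s : seq I) (F : I -> T -> R) : (forall i, bmeas (F i)) ->
  bmeas (fun x => \sum_(i <- s) F i x).
Proof.
move=> bF; elim: s => [|i s IH].
  by under eq_fun do rewrite big_nil; exact: bmeas_cst.
by under eq_fun do rewrite big_cons; exact: bmeasD.
Qed.

Variables (m : {measure set T -> \bar R}) (D : set T).
Hypothesis mD : measurable D.
Hypothesis fD : (m D < +oo)%E.

Lemma bmeas_integrable f : bmeas f -> m.-integrable D (EFin \o f).
Proof.
move=> [mf [M fM]]; apply: measurable_bounded_integrable => //; first exact: measurable_funTS.
exists M; split; first exact: num_real.
by move=> N MN x _ /=; apply: le_trans (fM x) _; exact: ltW.
Qed.

Lemma bmeas_EFin_Rintegral f : bmeas f ->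
  ((\int[m]_(x in D) f x)%:E = \int[m]_(x in D) (f x)%:E)%E.
Proof.
by move=> bf; rewrite /Rintegral fineK //; apply: integrable_fin_num => //; exact: bmeas_integrable.
Qed.

Lemma bmeas_RintegralD f g : bmeas f -> bmeas g ->
  \int[m]_(x in D) (f x + g x) = \int[m]_(x in D) f x + \int[m]_(x in D) g x.
Proof. by move=> bf bg; apply: RintegralD => //; exact: bmeas_integrable. Qed.

Lemma bmeas_RintegralB f g : bmeas f -> bmeas g ->
  \int[m]_(x in D) (f x - g x) = \int[m]_(x in D) f x - \int[m]_(x in D) g x.
Proof. by move=> bf bg; apply: RintegralB => //; exact: bmeas_integrable. Qed.

Lemma bmeas_RintegralZ (c : R) f : bmeas f ->
  \int[m]_(x in D) (c * f x) = c * \int[m]_(x in D) f x.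
Proof. by move=> bf; apply: RintegralZl => //; exact: bmeas_integrable. Qed.

Lemma bmeas_Rintegral_sum (I : Type) (s : seq I) (F : I -> T -> R) : (forall i, bmeas (F i)) ->
  \int[m]_(x in D) (\sum_(i <- s) F i x) = \sum_(i <- s) \int[m]_(x in D) F i x.
Proof.
move=> bF; elim: s => [|i s IH].
  rewrite big_nil; under eq_Rintegral do rewrite big_nil.
  by rewrite Rintegral_cst // mul0r.
rewrite big_cons -IH -bmeas_RintegralD //; last exact: bmeas_sum.
by apply: eq_Rintegral => x _; rewrite big_cons.
Qed.

Lemma bmeas_Rintegral_norm_le f (M : R) : bmeas f -> (forall x, `|f x| <= M) ->
  `|\int[m]_(x in D) f x| <= M * fine (m D).
Proof.
move=> bf fM; apply: le_trans (le_normr_Rintegral mD (bmeas_integrable bf)) _.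
rewrite -Rintegral_cst //; apply: le_Rintegral => //.
- have [mf [N fN]] := bf; apply: (@bmeas_integrable (fun x => `|f x|)); split.
    exact: measurableT_comp.
  by exists N => x; rewrite normr_id.
- exact: (@bmeas_integrable (fun=> M) (bmeas_cst M)).
Qed.

(** Nonnegativity of the integral of (f - r)^2, taken at the mean r of f; on a set of measure zero
    both sides vanish. *)
Lemma Rintegral_cauchy_schwarz f : bmeas f ->
  (\int[m]_(x in D) f x) ^+ 2 <= fine (m D) * \int[m]_(x in D) (f x ^+ 2).
Proof.
move=> bf; set I := \int[m]_(x in D) f x; set c := fine (m D).
have c0 : 0 <= c by rewrite fine_ge0.
have b2 := bmeasX 2 bf.
have h (r : R) : 0 <= \int[m]_(x in D) (f x ^+ 2) - 2 * r * I + r ^+ 2 * c.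
  have -> : \int[m]_(x in D) (f x ^+ 2) - 2 * r * I + r ^+ 2 * c = \int[m]_(x in D) (f x - r) ^+ 2.
    rewrite -(Rintegral_cst m mD) -bmeas_RintegralZ // -bmeas_RintegralB //; last exact: bmeasZ.
    rewrite -bmeas_RintegralD //; last 2 first.
    - by apply: bmeasB => //; exact: bmeasZ.
    - exact: bmeas_cst.
    by apply: eq_Rintegral => x _; ring.
  by apply: Rintegral_ge0 => x _; exact: sqr_ge0.
move: c0; rewrite le_eqVlt => /orP[/eqP c0|c0].
  have I0 : I = 0.
    have [_ [M fM]] := bf.
    by have := bmeas_Rintegral_norm_le bf fM; rewrite -/c -c0 mulr0 normr_le0 => /eqP.
  by rewrite I0 expr0n -c0 mul0r.
have := h (I / c); have -> : 2 * (I / c) * I = 2 * I ^+ 2 / c by ring.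
have -> : (I / c) ^+ 2 * c = I ^+ 2 / c by field; rewrite lt0r_neq0.
move=> {}h; rewrite -ler_pdivrMl //.
have -> : c^-1 * I ^+ 2 = I ^+ 2 / c by rewrite mulrC.
have e : 2 * I ^+ 2 / c = 2 * (I ^+ 2 / c) by ring.
by rewrite e in h; lra.
Qed.
End BoundedMeasurable.

(** * Fubini for bounded functions on a rectangle of finite measure *)

Section FubiniBounded.
Local Open Scope classical_set_scope.
Variable R : realType.
Local Notation mu := (@lebesgue_measure R).
Local Notation T := (measurableTypeR R).
Variables (A B : set T).
Hypotheses (mA : measurable A) (mB : measurable B).
Hypotheses (fA : (mu A < +oo)%E) (fB : (mu B < +oo)%E).

Lemma bmeas_section (f : T * T -> R) (t : T) : bmeas f -> bmeas (fun y => f (t, y)).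
Proof.
move=> [mf [M fM]]; split; last by exists M.
exact: (measurableT_comp mf (measurable_pair1 t)).
Qed.

Lemma leb2_setX_lty : (@leb2 R (A `*` B) < +oo)%E.
Proof.
rewrite /leb2 product_measure1E //; apply: lte_mul_pinfty => //.
by rewrite ge0_fin_numE.
Qed.

Let integrable_patch (f : T * T -> R) : bmeas f ->
  (@leb2 R).-integrable setT ((EFin \o f) \_ (A `*` B)).
Proof.
move=> bf; apply: (proj1 (@integrable_mkcond _ _ _ (@leb2 R) (A `*` B) (EFin \o f) (measurableX mA mB))).
apply: (@bmeas_integrable _ _ _ _ (A `*` B)) => //; first exact: measurableX.
exact: leb2_setX_lty.
Qed.

Let fubini_patch (f : T * T -> R) t : bmeas f ->
  fubini_F mu ((EFin \o f) \_ (A `*` B)) t =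
  (((fun t => \int[mu]_(y in B) f (t, y)) \_ A) t)%:E.
Proof.
move=> bf; rewrite /fubini_F [in RHS]/patch; case: ifPn => tA.
  rewrite bmeas_EFin_Rintegral //; last exact: bmeas_section.
  rewrite [RHS]integral_mkcond; apply: eq_integral => y _; rewrite /patch /=.
  have -> // : ((t, y) \in A `*` B) = (y \in B).
  by apply/idP/idP; rewrite !inE /=; [case|move: tA; rewrite inE].
rewrite -[RHS](integral0 mu setT); apply: eq_integral => y _; rewrite /patch ifF //.
by apply/negbTE; move: tA; apply: contra; rewrite !inE => -[].
Qed.

Lemma bmeas_marginal (f : T * T -> R) : bmeas f ->
  bmeas ((fun t => \int[mu]_(y in B) f (t, y)) \_ A).
Proof.
move=> bf; split.
  have /integrable_fubini_F/measurable_int := integrable_patch bf.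
  have -> : fubini_F mu ((EFin \o f) \_ (A `*` B)) =
      EFin \o ((fun t => \int[mu]_(y in B) f (t, y)) \_ A).
    by apply/funext => t; exact: fubini_patch.
  by move/measurable_EFinP.
have [_ [M fM]] := bf; exists (M * fine (mu B)) => t.
have h := bmeas_Rintegral_norm_le mB fB (bmeas_section t bf) (fun y => fM (t, y)).
rewrite /patch; case: ifPn => // _; rewrite normr0.
exact: le_trans (normr_ge0 _) h.
Qed.

Lemma Rintegral_fubini (f : T * T -> R) : bmeas f ->
  (\int[@leb2 R]_(x in A `*` B) (f x)%:E =
   (\int[mu]_(t in A) \int[mu]_(y in B) f (t, y))%:E)%E.
Proof.
move=> bf; rewrite integral_mkcond /leb2 -integral12_prod_meas1; last exact: integrable_patch.
transitivity (\int[mu]_(t in setT) (((fun t => \int[mu]_(y in B) f (t, y)) \_ A) t)%:E)%E.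
  by apply: eq_integral => t _; exact: fubini_patch.
rewrite -[RHS]/((\int[mu]_(t in A) (fun t => \int[mu]_(y in B) f (t, y)) t)%:E).
rewrite Rintegral_mkcond.
have bg := bmeas_marginal bf.
have -> : \int[mu]_t ((fun t => \int[mu]_(y in B) f (t, y)) \_ A) t
   = \int[mu]_(t in A) ((fun t => \int[mu]_(y in B) f (t, y)) \_ A) t.
  by rewrite [RHS]Rintegral_mkcond; apply: eq_Rintegral => t _; rewrite /patch; case: ifP.
rewrite bmeas_EFin_Rintegral // [RHS]integral_mkcond.
by apply: eq_integral => t _; rewrite /patch; case: ifPn.
Qed.
End FubiniBounded.

(** * Fourier coefficients on the circle and Bessel's inequality *)

Section Bessel.
Local Open Scope classical_set_scope.
Variable R : realType.
Local Notation mu := (@lebesgue_measure R).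
Definition circ : set R := `[0, 2 * pi[.
Local Notation J := circ.

Lemma measurable_circ : measurable J. Proof. exact: measurable_itv. Qed.

Lemma mu_circ : mu J = (2 * pi)%:E.
Proof.
rewrite /circ lebesgue_measure_itv /= lte_fin mulr_gt0 ?pi_gt0 //.
by rewrite -EFinB subr0.
Qed.

Lemma mu_circ_lty : (mu J < +oo)%E. Proof. by rewrite mu_circ ltry. Qed.

Lemma bmeas_cos (k : R) : bmeas (fun y : R => cos (k * y)).
Proof.
split; last by exists 1 => y; rewrite ler_norml cos_geN1 cos_le1.
apply: continuous_measurable_fun; apply: derivable_continuous => y.
have h : is_derive y 1 (fun y : R => k * y) k by apply: is_derive_eq; rewrite /GRing.scale /=; ring.
by have := @is_derive1_comp R cos (fun y : R => k * y) y _ _ (is_derive_cos _) h; case.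
Qed.

Lemma bmeas_sin (k : R) : bmeas (fun y : R => sin (k * y)).
Proof.
split; last by exists 1 => y; rewrite ler_norml sin_geN1 sin_le1.
apply: continuous_measurable_fun; apply: derivable_continuous => y.
have h : is_derive y 1 (fun y : R => k * y) k by apply: is_derive_eq; rewrite /GRing.scale /=; ring.
by have := @is_derive1_comp R sin (fun y : R => k * y) y _ _ (is_derive_sin _) h; case.
Qed.

Lemma cos_sin_int2pi (k : int) : cos (k%:~R * (2 * pi)) = 1 :> R /\ sin (k%:~R * (2 * pi)) = 0 :> R.
Proof.
have h (n : nat) : cos (n%:R * (2 * pi)) = 1 :> R /\ sin (n%:R * (2 * pi)) = 0 :> R.
  elim: n => [|n [c s]]; first by rewrite mul0r cos0 sin0.
  rewrite -natr1 mulrDl mul1r cosD sinD c s mulr_natl cos2pi sin2pi.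
  by split; ring.
case: k => n; first exact: h.
by rewrite NegzE mulrNz mulNr cosN sinN; have [-> ->] := h n.+1; rewrite oppr0.
Qed.

Lemma Rintegral_circ_derive (f F : R -> R) : (forall x : R, is_derive x 1 F (f x)) ->
  continuous f -> \int[mu]_(y in J) f y = F (2 * pi) - F 0.
Proof.
move=> dF cf; have p0 : 0 < 2 * pi :> R by rewrite mulr_gt0 ?pi_gt0.
rewrite /Rintegral /circ integral_itv_bndo_bndc; last first.
  by apply/measurable_EFinP; apply: measurable_funTS; exact: continuous_measurable_fun.
by rewrite (integral_derive_itv p0 (fun x _ => dF x) (continuous_subspaceT cf)).
Qed.

Lemma Rintegral_cos (k : int) : \int[mu]_(y in J) cos (k%:~R * y) = if k == 0 then 2 * pi else 0 :> R.
Proof.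
case: ifPn => k0.
  rewrite (eqP k0); under eq_Rintegral do rewrite mul0r cos0.
  transitivity (1 * fine (mu J)); first by apply: Rintegral_cst; exact: measurable_circ.
  by rewrite mu_circ mul1r.
have K0 : k%:~R != 0 :> R by rewrite intr_eq0.
have dF (y : R) : is_derive y 1 (fun y : R => sin (k%:~R * y) / k%:~R) (cos (k%:~R * y)).
  have h : is_derive y 1 (fun y : R => k%:~R * y) (k%:~R) by apply: is_derive_eq; rewrite /GRing.scale /=; ring.
  have h2 := @is_derive1_comp R sin (fun y : R => k%:~R * y) y _ _ (is_derive_sin _) h.
  by apply: is_derive_eq; rewrite /GRing.scale /=; field.
have cf : continuous (fun y : R => cos (k%:~R * y)).
  move=> y; apply: continuous_comp; last exact: continuous_cos.
  by apply: cvgM; [exact: cvg_cst|exact: cvg_id].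
rewrite (Rintegral_circ_derive dF cf).
by have [_ ->] := cos_sin_int2pi k; rewrite mulr0 sin0 subrr.
Qed.

Lemma Rintegral_sin (k : int) : \int[mu]_(y in J) sin (k%:~R * y) = 0 :> R.
Proof.
have [->|k0] := eqVneq k 0.
  under eq_Rintegral do rewrite mul0r sin0.
  by rewrite Rintegral_cst; [rewrite mul0r|exact: measurable_circ].
have K0 : k%:~R != 0 :> R by rewrite intr_eq0.
have dF (y : R) : is_derive y 1 (fun y : R => - cos (k%:~R * y) / k%:~R) (sin (k%:~R * y)).
  have h : is_derive y 1 (fun y : R => k%:~R * y) (k%:~R) by apply: is_derive_eq; rewrite /GRing.scale /=; ring.
  have h2 := @is_derive1_comp R cos (fun y : R => k%:~R * y) y _ _ (is_derive_cos _) h.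
  by apply: is_derive_eq; rewrite /GRing.scale /=; field.
have cf : continuous (fun y : R => sin (k%:~R * y)).
  move=> y; apply: continuous_comp; last exact: continuous_sin.
  by apply: cvgM; [exact: cvg_cst|exact: cvg_id].
rewrite (Rintegral_circ_derive dF cf).
by have [-> _] := cos_sin_int2pi k; rewrite mulr0 cos0 subrr.
Qed.

(* real and imaginary parts of the k-th Fourier coefficient of A + iB *)
Definition fre (A B : R -> R) (k : int) : R :=
  \int[mu]_(y in J) (A y * cos (k%:~R * y) + B y * sin (k%:~R * y)).
Definition fim (A B : R -> R) (k : int) : R :=
  \int[mu]_(y in J) (B y * cos (k%:~R * y) - A y * sin (k%:~R * y)).

Lemma bessel (A B : R -> R) n (k : 'I_n -> int) : bmeas A -> bmeas B -> injective k ->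
  \sum_i (fre A B (k i) ^+ 2 + fim A B (k i) ^+ 2) <=
    2 * pi * \int[mu]_(y in J) (A y ^+ 2 + B y ^+ 2).
Proof.
move=> bA bB kinj.
have mJ := measurable_circ; have fJ := mu_circ_lty.
have bc := bmeas_cos; have bs := bmeas_sin.
pose c i := fre A B (k i); pose d i := fim A B (k i).
(* [S] and [W] are the real and imaginary parts of the partial Fourier sum, of coefficients c_i + i
   d_i, not yet divided by 2 pi. *)
pose S y := \sum_i (c i * cos ((k i)%:~R * y) - d i * sin ((k i)%:~R * y)).
pose W y := \sum_i (c i * sin ((k i)%:~R * y) + d i * cos ((k i)%:~R * y)).
have bS : bmeas S by apply: bmeas_sum => i; apply: bmeasB; apply: bmeasZ.
have bW : bmeas W by apply: bmeas_sum => i; apply: bmeasD; apply: bmeasZ.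
have brem (A' B' : R -> R) i : bmeas A' -> bmeas B' ->
    bmeas (fun y : R => A' y * cos ((k i)%:~R * y) + B' y * sin ((k i)%:~R * y)).
  by move=> bA' bB'; apply: bmeasD; apply: bmeasM.
have bimm (A' B' : R -> R) i : bmeas A' -> bmeas B' ->
    bmeas (fun y : R => B' y * cos ((k i)%:~R * y) - A' y * sin ((k i)%:~R * y)).
  by move=> bA' bB'; apply: bmeasB; apply: bmeasM.
have pair (A' B' : R -> R) : bmeas A' -> bmeas B' ->
    \int[mu]_(y in J) (A' y * S y + B' y * W y)
    = \sum_i (c i * fre A' B' (k i) + d i * fim A' B' (k i)).
  move=> bA' bB'.
  transitivity (\int[mu]_(y in J) \sum_i
     (c i * (A' y * cos ((k i)%:~R * y) + B' y * sin ((k i)%:~R * y))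
     + d i * (B' y * cos ((k i)%:~R * y) - A' y * sin ((k i)%:~R * y)))).
    apply: eq_Rintegral => y _; rewrite /S /W !mulr_sumr -big_split /=.
    by apply: eq_bigr => i _; ring.
  rewrite bmeas_Rintegral_sum //; last first.
    by move=> i; apply: bmeasD; apply: bmeasZ; [exact: brem|exact: bimm].
  apply: eq_bigr => i _; rewrite bmeas_RintegralD ?bmeas_RintegralZ //.
  - exact: bimm.
  - exact: brem.
  - by apply: bmeasZ; exact: brem.
  - by apply: bmeasZ; exact: bimm.
have kB i j y : ((k i - k j)%:~R * y : R) = (k i)%:~R * y - (k j)%:~R * y.
  by rewrite rmorphB /= mulrBl.
have delta i (e : 'I_n -> R) :
    \sum_j e j * (if k j - k i == 0 then 2 * pi else 0) = 2 * pi * e i.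
  rewrite (bigD1 i isT) subrr eqxx big1 => [|j /andP[_ ji]]; first by rewrite -[LHS]/(e i * (2 * pi) + 0) addr0 mulrC.
  by rewrite subr_eq0 (inj_eq kinj) (negbTE ji) mulr0.
have freS i : fre S W (k i) = 2 * pi * c i.
  rewrite -(delta i c) /fre.
  transitivity (\int[mu]_(y in J) \sum_j
     (c j * cos ((k j - k i)%:~R * y) - d j * sin ((k j - k i)%:~R * y))).
    apply: eq_Rintegral => y _; rewrite /S /W !mulr_suml -big_split /=.
    by apply: eq_bigr => j _; rewrite kB cosB sinB; ring.
  rewrite bmeas_Rintegral_sum //; last first.
    by move=> j; apply: bmeasB; apply: bmeasZ; [exact: bc|exact: bs].
  apply: eq_bigr => j _; rewrite bmeas_RintegralB ?bmeas_RintegralZ //; try solve [exact: bc | exact: bs | apply: bmeasZ; exact: bc | apply: bmeasZ; exact: bs].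
  by rewrite Rintegral_cos Rintegral_sin mulr0 subr0.
have fimS i : fim S W (k i) = 2 * pi * d i.
  rewrite -(delta i d) /fim.
  transitivity (\int[mu]_(y in J) \sum_j
     (d j * cos ((k j - k i)%:~R * y) + c j * sin ((k j - k i)%:~R * y))).
    apply: eq_Rintegral => y _; rewrite /S /W !mulr_suml -sumrB /=.
    by apply: eq_bigr => j _; rewrite kB cosB sinB; ring.
  rewrite bmeas_Rintegral_sum //; last first.
    by move=> j; apply: bmeasD; apply: bmeasZ; [exact: bc|exact: bs].
  apply: eq_bigr => j _; rewrite bmeas_RintegralD ?bmeas_RintegralZ //; try solve [exact: bc | exact: bs | apply: bmeasZ; exact: bc | apply: bmeasZ; exact: bs].
  by rewrite Rintegral_cos Rintegral_sin mulr0 addr0.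
set E := \sum_i _; have p0 := @pi_gt0 R; pose q : R := (2 * pi)^-1.
have E1 : \int[mu]_(y in J) (A y * S y + B y * W y) = E.
  by rewrite pair //; apply: eq_bigr => i _; rewrite -!expr2.
have E2 : \int[mu]_(y in J) (S y * S y + W y * W y) = 2 * pi * E.
  rewrite pair // mulr_sumr; apply: eq_bigr => i _.
  by rewrite freS fimS /c /d; ring.
(* The squared norm of A + i B minus its partial Fourier sum; expanding it by [E1] and [E2] gives
   the inequality. *)
have : 0 <= \int[mu]_(y in J) ((A y - q * S y) ^+ 2 + (B y - q * W y) ^+ 2).
  by apply: Rintegral_ge0 => y _; apply: addr_ge0; exact: sqr_ge0.
have -> : \int[mu]_(y in J) ((A y - q * S y) ^+ 2 + (B y - q * W y) ^+ 2) =
   \int[mu]_(y in J) (A y ^+ 2 + B y ^+ 2) - 2 * q * E + q ^+ 2 * (2 * pi * E).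
  have b1 : bmeas (fun y => A y ^+ 2 + B y ^+ 2) by apply: bmeasD; exact: bmeasX.
  have b2 : bmeas (fun y => A y * S y + B y * W y) by apply: bmeasD; exact: bmeasM.
  have b3 : bmeas (fun y => S y * S y + W y * W y) by apply: bmeasD; exact: bmeasM.
  rewrite -E2 -{1}E1 -!bmeas_RintegralZ // -bmeas_RintegralB //; last exact: bmeasZ.
  rewrite -bmeas_RintegralD //; last 2 first.
  - by apply: bmeasB => //; exact: bmeasZ.
  - exact: bmeasZ.
  by apply: eq_Rintegral => y _; ring.
have qp : q * (2 * pi) = 1 by rewrite mulVf // mulf_neq0 // lt0r_neq0.
have -> : q ^+ 2 * (2 * pi * E) = q * (q * (2 * pi)) * E by ring.
rewrite qp mulr1.
move=> h; rewrite -ler_pdivrMl ?mulr_gt0 // -/q; lra.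
Qed.
End Bessel.

(** * The kernel in the two variables (a, tau): boundedness, cutoff and uniform estimate *)

Section Kernel.
Local Open Scope classical_set_scope.
Variable R : realType.
Local Notation mu := (@lebesgue_measure R).
Local Notation posR := (@posR R).

Lemma measurable_horner (p : {poly R}) : measurable_fun setT (horner p).
Proof. by apply: continuous_measurable_fun; exact: continuous_horner. Qed.

Lemma measurable_xb : measurable_fun setT (@xb R).
Proof. by apply: continuous_measurable_fun; exact: continuous_xb. Qed.

Lemma measurable_inv_one_sqr : measurable_fun setT (fun b : R => (1 + b ^+ 2)^-1).
Proof.
apply: continuous_measurable_fun => b; apply: cvgV; first exact: one_sqr_neq0.
by apply: cvgD; [exact: cvg_cst|apply: cvgM; exact: cvg_id].
Qed.

Lemma measurable_legendreP l (m : int) : measurable_fun setT (@legendreP R l m).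
Proof.
apply: measurable_funM; last exact: measurable_horner.
apply: measurable_funM; first exact: measurable_cst.
apply: (measurableT_comp (measurable_powR _)).
apply: measurable_funB; first exact: measurable_cst.
by apply: measurable_funX; exact: measurable_id.
Qed.

Lemma measurable_Qm l (m : int) : measurable_fun setT (@Qm R l m).
Proof.
apply: measurable_funM; last exact: measurable_inv_one_sqr.
apply: measurable_funM; first exact: measurable_cst.
exact: (measurableT_comp (measurable_legendreP l m) measurable_xb).
Qed.

(** Set to 0 off b > 0, so that boundedness only has to be checked where 1 - x^2 > 0 and
    [Ynorm_legendreP_sqr] applies. *)
Definition Kpos l (m : int) (b : R) : R := if 0 < b then Qm l m b else 0.

Lemma measurable_Kpos l (m : int) : measurable_fun setT (Kpos l m).
Proof.
apply: measurable_fun_ifT; [|exact: measurable_Qm|exact: measurable_cst].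
exact: measurable_fun_ltr.
Qed.

Lemma horner_norm_le (p : {poly R}) (x : R) : -1 <= x <= 1 ->
  `|p.[x]| <= \sum_(i < size p) `|p`_i|.
Proof.
move=> x1; rewrite horner_coef; apply: le_trans (ler_norm_sum _ _ _) _.
apply: ler_sum => i _; rewrite normrM normrX ler_piMr // exprn_ile1 // ler_norml //.
Qed.

(** A crude bound, not uniform in l, used only to make the integrands in tau bounded. *)
Lemma Kpos_bounded l (m : int) : (absz m <= l)%N -> exists M, forall b, `|Kpos l m b| <= M.
Proof.
move=> ml; set k := absz m in ml *.
pose p : {poly R} := sg R ^+ k * rodr R l (l + k) ^+ 2.
pose c : R := (2 * l + 1)%:R / (4 * pi) * ((l - k)`!%:R / (l + k)`!%:R) / (2 ^+ l * l`!%:R) ^+ 2.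
pose B := c * \sum_(i < size p) `|p`_i|.
have c0 : 0 <= c by rewrite !(mulr_ge0, invr_ge0, exprn_ge0, pi_ge0).
have B0 : 0 <= B by apply: mulr_ge0 => //; apply: sumr_ge0 => i _; exact: normr_ge0.
(* Only the square is bounded by [B], and |q| <= 1 + q^2. *)
exists (1 + B) => b; rewrite /Kpos; case: ifPn => b0; last by rewrite normr0; lra.
have s0 := sg_xb_gt0 b0; rewrite sg_xb in s0.
have h : (Ynorm R l m * legendreP l m (xb b)) ^+ 2 <= B.
  rewrite (@Ynorm_legendreP_sqr R l m k) // -/c /B; apply: ler_wpM2l => //.
  apply: le_trans (horner_norm_le p (xb_bound b)).
  by rewrite /p hornerM !horner_exp ler_norm.
have h2 : Qm l m b ^+ 2 <= B.
  apply: le_trans h; rewrite /Qm expr_div_n ler_pdivrMr ?exprn_gt0 ?one_sqr_gt0 //.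
  by rewrite ler_peMr ?sqr_ge0 // exprn_ege1 // lerDl sqr_ge0.
by rewrite ler_norml; apply/andP; split; nra.
Qed.

Lemma chiE (be : R) : chi be = \1_[set b : R | b < be] :> (R -> R).
Proof.
apply/funext => b; rewrite /chi indicE; congr ((nat_of_bool _)%:R).
by apply/idP/idP; rewrite inE.
Qed.

Lemma measurable_chi (be : R) : measurable_fun setT (chi be).
Proof. by rewrite chiE; apply: measurable_indic; apply: open_measurable; exact: open_lt. Qed.

(** The two cutoffs differ only between be / s and be, an interval of da/a-length |ln s|. Bounding
    1/a by its value at the left endpoint gives s - 1 or 1/s - 1 and avoids the logarithm. *)
Lemma integral_chi_scale_le (be s : R) : 0 < be -> 0 < s ->
  (\int[mu]_(a in posR) ((chi be (a * s) - chi be a) ^+ 2 / a)%:E <= (s + s^-1)%:E)%E.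
Proof.
move=> be0 s0.
have [lo [hi [lo0 lohi hle hin]]] : exists lo, exists hi, [/\ 0 < lo, lo <= hi,
   (hi - lo) / lo <= s + s^-1 &
   forall a, 0 < a -> (a < be) != (a * s < be) -> lo <= a <= hi].
  have sV : 0 < s^-1 by rewrite invr_gt0.
  have [s1|s1] := leP 1 s.
    exists (be / s), be; split.
    - exact: divr_gt0.
    - by rewrite ler_pdivrMr // ler_peMr // ltW.
    - have -> : (be - be / s) / (be / s) = s - 1 by field; rewrite !lt0r_neq0.
      by lra.
    - move=> a a0; have [ab|ab] := ltP a be; have [asb|asb] := ltP (a * s) be => // _.
        by rewrite (ltW ab) ler_pdivrMr // asb.
      by have : a <= a * s by [rewrite ler_peMr // ltW]; lra.
  exists be, (be / s); split => //.
  - by rewrite ler_pdivlMr // ler_piMr // ltW.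
  - have -> : (be / s - be) / be = s^-1 - 1 by field; rewrite !lt0r_neq0.
    by lra.
  - move=> a a0; have [ab|ab] := ltP a be; have [asb|asb] := ltP (a * s) be => // _.
      by have : a * s <= a by [rewrite ler_piMr // ltW]; lra.
    by rewrite /= ler_pdivlMr // ltW.
pose A : set R := `[lo, hi].
apply: (@le_trans _ _ (\int[mu]_(a in posR) (((cst (lo^-1)%:E) \_ A) a))%E).
  apply: le_integral_ge0 => a a0; first by rewrite lee_fin divr_ge0 ?sqr_ge0 // ltW.
  rewrite /patch; case: ifPn => aA /=.
    rewrite lee_fin; have /andP[la _] : lo <= a <= hi by move: aA; rewrite inE /A /= in_itv.
    have aV : a^-1 <= lo^-1 by rewrite lef_pV2.
    apply: le_trans aV; rewrite ler_piMl ?invr_ge0 ?(ltW a0) // /chi.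
    by case: (_ < _); case: (_ < _); rewrite ?subrr ?subr0 ?sub0r ?sqrrN ?expr1n ?expr0n.
  have -> : chi be (a * s) = chi be a.
    rewrite /chi; congr ((nat_of_bool _)%:R); apply/eqP; apply: contraNT aA.
    by rewrite eq_sym => /(hin a a0); rewrite inE /A /= in_itv.
  by rewrite subrr expr0n mul0r.
apply: le_trans (integral_restrict_le _ _) _.
  by move=> x _; rewrite lee_fin invr_ge0 ltW.
rewrite integral_cst; last exact: measurable_itv.
have eA : mu A = (hi - lo)%:E.
  rewrite /A lebesgue_measure_itv /= lte_fin; case: ltP => [_|hl]; first by rewrite EFinB.
  by have -> : hi = lo by [apply/eqP; rewrite eq_le hl lohi]; rewrite subrr.
suff : ((lo^-1)%:E * mu A <= (s + s^-1)%:E)%E by [].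
by rewrite eA -EFinM lee_fin mulrC.
Qed.

Lemma Qm0E l (b : R) : Qm l 0 b = Ynorm R l 0 * q0 l b.
Proof.
rewrite /Qm /q0 [RHS]mulrA; congr (_ * _ * _).
have e : absz (l%:Z + 0) = l by lia.
by rewrite /legendreP /legp hornerZ e mul0r powRr0 mulr1 expr0z mul1r.
Qed.

Lemma Ynorm0_sqr_le l : Ynorm R l 0 ^+ 2 <= (2 * l + 1)%:R.
Proof.
suff : forall m : int, m = 0 -> Ynorm R l m ^+ 2 <= (2 * l + 1)%:R by apply.
move=> m m0.
have p0 := @pi_gt0 R; have p2 := @pi_ge2 R.
have f0 : (l`!)%:R != 0 :> R by rewrite pnatr_eq0 -lt0n fact_gt0.
have e1 : absz (l%:Z - m) = l by lia.
have e2 : absz (l%:Z + m) = l by lia.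
rewrite /Ynorm e1 e2 sqr_sqrtr; last by rewrite !mulr_ge0 ?invr_ge0 ?mulr_ge0 ?pi_ge0.
rewrite mulfK // ler_pdivrMr; last by lra.
by rewrite ler_peMr //; lra.
Qed.

(* The angular average of the mother function vanishes, so subtracting from the
   zonal kernel a function of [a] alone changes nothing and makes it integrable. *)
Definition kap l (m : int) (be a t : R) : R :=
  Kpos l m (a * tan (t / 2)) - (m == 0)%:R * Ynorm R l 0 * chi be a.

(** The cutoff [be] is chosen before [t]: it has to be the same for all tau in order to be
    annihilated by (C). The constant 9 covers both the 1 of the case m <> 0 and the 8 of the case m
    = 0. *)
Lemma integral_kap_le l (m : int) : (absz m <= l)%N -> exists be : R, forall t, 0 < t < pi ->
  (\int[mu]_(a in posR) (kap l m be a t ^+ 2 / a)%:E <= ((2 * l + 1)%:R * (9 + 4 / sin t))%:E)%E.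
Proof.
move=> ml; have L0 : 0 <= (2 * l + 1)%:R :> R by [].
have sp (t : R) : 0 < t < pi -> 0 < sin t by move=> ht; apply: sin_gt0_pi.
have [m0|m0] := eqVneq m 0; last first.
  (* For m <> 0 the subtracted term is multiplied by zero, so the cutoff is arbitrary. *)
  exists 0 => t ht; have s0 := tan_half_gt0 ht.
  rewrite /kap; under eq_integral do rewrite (negbTE m0) mul0r mul0r subr0.
  have := @integral_scale_haar R (fun b => Kpos l m b ^+ 2) (tan (t / 2)) s0 _ _.
  move=> -> //; last first.
  - by move=> x; exact: sqr_ge0.
  - by apply: measurable_funX; exact: measurable_Kpos.
  apply: (@le_trans _ _ (\int[mu]_(b in posR) (Qm l m b ^+ 2 / b)%:E)%E).
    apply: le_integral_ge0 => b b0; first by rewrite lee_fin divr_ge0 ?sqr_ge0 // ltW.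
    by rewrite /Kpos (_ : 0 < b).
  have hm : (0 < absz m <= l)%N by rewrite ml andbT absz_gt0.
  apply: le_trans (@integral_Qm_le R l m hm) _.
  rewrite lee_fin ler_peMr //.
  have : 0 <= 4 / sin t by rewrite divr_ge0 // ltW // sp.
  by lra.
have [be be0 hq] := integral_q0_le R l; exists be => t ht.
have s0 := tan_half_gt0 ht; set s := tan (t / 2) in s0 *.
have mp := @measurable_posR R.
pose f1 (a : R) := (q0 l (a * s) - chi be (a * s)) ^+ 2 / a.
pose f2 (a : R) := (chi be (a * s) - chi be a) ^+ 2 / a.
pose Y2 : R := Ynorm R l 0 ^+ 2.
have Y0 : 0 <= Y2 by exact: sqr_ge0.
have ms : measurable_fun setT (fun a : R => a * s) by apply: measurable_funM; [exact: measurable_id|exact: measurable_cst].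
have mq : measurable_fun setT (@q0 R l).
  apply: measurable_funM; last exact: measurable_inv_one_sqr.
  exact: (measurableT_comp (measurable_horner _) measurable_xb).
have mc := measurable_chi be.
have mqc : measurable_fun setT (fun b => (q0 l b - chi be b) ^+ 2).
  by apply: measurable_funX; exact: measurable_funB.
have mf1 : measurable_fun posR f1.
  apply: measurable_funM; last exact: measurable_inv_posR.
  by apply: measurable_funTS; exact: (measurableT_comp mqc ms).
have mf2 : measurable_fun posR f2.
  apply: measurable_funM; last exact: measurable_inv_posR.
  apply: measurable_funTS; apply: measurable_funX; apply: measurable_funB => //.
  exact: (measurableT_comp mc ms).
have f10 a : posR a -> 0 <= f1 a by move=> a0; rewrite divr_ge0 ?sqr_ge0 // ltW.
have f20 a : posR a -> 0 <= f2 a by move=> a0; rewrite divr_ge0 ?sqr_ge0 // ltW.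
have I1 : (\int[mu]_(a in posR) (f1 a)%:E <= 4%:E)%E.
  rewrite (@integral_scale_haar R (fun b => (q0 l b - chi be b) ^+ 2) s) // => x.
  exact: sqr_ge0.
have I2 := integral_chi_scale_le be0 s0.
(* The kernel is split as q0(as) - chi(as), which depends on as only and is integrated by scale
   invariance, plus the mismatch chi(as) - chi(a); then (x + y)^2 <= 2 x^2 + 2 y^2. *)
apply: (@le_trans _ _ (\int[mu]_(a in posR) ((2 * Y2)%:E * ((f1 a)%:E + (f2 a)%:E)))%E).
  apply: le_integral_ge0 => a a0; first by rewrite lee_fin divr_ge0 ?sqr_ge0 // ltW.
  have as0 : 0 < a * s by rewrite mulr_gt0.
  rewrite -EFinD -EFinM lee_fin /kap m0 eqxx mul1r /Kpos as0 Qm0E /f1 /f2 /Y2 -mulrDl mulrA.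
  apply: ler_wpM2r; first by rewrite invr_ge0 ltW.
  rewrite -/s; move: (q0 l (a * s)) (chi be (a * s)) (chi be a) (Ynorm R l 0) => x y z Y.
  have -> : 2 * Y ^+ 2 * ((x - y) ^+ 2 + (y - z) ^+ 2) = (Y * x - Y * z) ^+ 2 + (Y * (x - y) - Y * (y - z)) ^+ 2 by ring.
  by rewrite lerDl sqr_ge0.
rewrite ge0_integralZl_EFin //; last 3 first.
- by move=> a a0; apply: adde_ge0; rewrite lee_fin; [exact: f10|exact: f20].
- by apply: emeasurable_funD; exact/measurable_EFinP.
- by rewrite mulr_ge0.
rewrite ge0_integralD //; last 2 first.
- exact/measurable_EFinP.
- exact/measurable_EFinP.
apply: (@le_trans _ _ ((2 * Y2)%:E * (4%:E + (s + s^-1)%:E))%E).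
  by apply: lee_wpmul2l; [rewrite lee_fin mulr_ge0|exact: leeD].
rewrite -EFinD -EFinM lee_fin.
have -> : s + s^-1 = 2 / sin t.
  have n0 := lt0r_neq0 s0; have n1 := one_sqr_neq0 s.
  by rewrite (sinE_tan ht) -/s; field; rewrite ?n0 ?n1.
have S0 : 0 <= 2 / sin t by rewrite divr_ge0 // ltW // sp.
have h := Ynorm0_sqr_le l; rewrite -/Y2 in h.
have -> : 4 / sin t = 2 * (2 / sin t) by ring.
move: (2 / sin t) S0 => S S0.
have : Y2 * (8 + 2 * S) <= (2 * l + 1)%:R * (8 + 2 * S) by apply: ler_wpM2r => //; lra.
by move: h L0; move: ((2 * l + 1)%:R) => L h L0; nra.
Qed.

Lemma measurable_tan_half :
  measurable_fun setT (fun t : R => if 0 < t < pi then tan (t / 2) else 0).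
Proof.
apply: measurable_fun_if => //.
- apply: measurable_and; apply: measurable_fun_ltr => //.
- have -> : [set: R] `&` (fun t : R => 0 < t < pi) @^-1` [set true] = `]0, pi[%classic.
    by apply/seteqP; split => t /=; rewrite in_itv /=; [case|].
  apply: open_continuous_measurable_fun; first exact: interval_open.
  move=> t; rewrite inE /= in_itv /= => ht.
  apply: (@continuous_comp _ _ _ (fun t : R => t / 2) tan).
    by apply: cvgM; [exact: cvg_id|exact: cvg_cst].
  by apply: continuous_tan; rewrite lt0r_neq0 // cos_half_gt0.
Qed.

Lemma measurable_kap l (m : int) (be : R) :
  measurable_fun setT (fun x : measurableTypeR R * measurableTypeR R => if 0 < x.2 < pi then kap l m be x.1 x.2 else 0).
Proof.
have m2 := measurable_tan_half.
have -> : (fun x : measurableTypeR R * measurableTypeR R => if 0 < x.2 < pi then kap l m be x.1 x.2 else 0) =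
  (fun x => if 0 < x.2 < pi then Kpos l m (x.1 * (if 0 < x.2 < pi then tan (x.2 / 2) else 0))
     - (m == 0)%:R * Ynorm R l 0 * chi be x.1 else 0).
  by apply/funext => x; rewrite /kap; case: ifP.
apply: measurable_fun_ifT.
- by apply: measurable_and; apply: measurable_fun_ltr => //; exact: measurable_snd.
- apply: measurable_funB.
    apply: (measurableT_comp (measurable_Kpos l m)).
    apply: measurable_funM; first exact: measurable_fst.
    exact: (measurableT_comp m2 measurable_snd).
  apply: measurable_funM; first exact: measurable_cst.
  exact: (measurableT_comp (measurable_chi be) measurable_fst).
- exact: measurable_cst.
Qed.

End Kernel.

(** * The a-integral of the squared coefficients, summed over the orders m *)

Section SchurBound.
Local Open Scope classical_set_scope.
Variable R : realType.
Local Notation mu := (@lebesgue_measure R).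
Local Notation posR := (@posR R).
Local Notation T := (measurableTypeR R).

Definition colat : set R := `]0, pi[.
Local Notation I := colat.
Local Notation J := (@circ R).

Lemma measurable_colat : measurable I. Proof. exact: measurable_itv. Qed.

Lemma mu_colat : mu I = pi%:E.
Proof. by rewrite /colat lebesgue_measure_itv /= lte_fin pi_gt0 -EFinB subr0. Qed.

Lemma mu_colat_lty : (mu I < +oo)%E. Proof. by rewrite mu_colat ltry. Qed.

Lemma colatE (t : R) : (t \in I) = (0 < t < pi).
Proof. by apply/idP/idP; rewrite inE /colat /= in_itv. Qed.

(** The density of da/a, extended by 0 so that Tonelli can be applied on the whole plane. *)
Definition invp (a : R) : R := if 0 < a then a^-1 else 0.

Lemma measurable_invp : measurable_fun setT (invp : T -> R).
Proof.
have -> : invp = (fun a : R => a^-1) \_ posR.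
  apply/funext => a; rewrite /invp /patch; congr (if _ then _ else _).
  by apply/idP/idP; rewrite inE.
apply/(measurable_restrictT _ _).1; first exact: measurable_posR.
exact: measurable_inv_posR.
Qed.

Lemma invp_ge0 a : 0 <= invp a.
Proof. by rewrite /invp; case: ifPn => // a0; rewrite invr_ge0 ltW. Qed.

Variables (U V : T * T -> R) (c : R).
Hypotheses (bU : bmeas U) (bV : bmeas V).
Hypothesis hU : forall t y, 0 < t < pi -> `|U (t, y)| <= c * sin t.
Hypothesis hV : forall t y, 0 < t < pi -> `|V (t, y)| <= c * sin t.
Hypothesis U0 : \int[mu]_(t in I) \int[mu]_(y in J) U (t, y) = 0.
Hypothesis V0 : \int[mu]_(t in I) \int[mu]_(y in J) V (t, y) = 0.

Let gre (m : int) (t : R) := fre (fun y => U (t, y)) (fun y => V (t, y)) m.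
Let gim (m : int) (t : R) := fim (fun y => U (t, y)) (fun y => V (t, y)) m.

Let mJ : measurable (J : set T) := @measurable_circ R.
Let fJ : (mu J < +oo)%E := @mu_circ_lty R.
Let mI : measurable (I : set T) := measurable_colat.
Let fI : (mu I < +oo)%E := mu_colat_lty.

Let bcos (k : R) : bmeas (fun x : T * T => cos (k * x.2)).
Proof.
have [mc [M hM]] := bmeas_cos k; split; last by exists M.
exact: (measurableT_comp mc measurable_snd).
Qed.

Let bsin (k : R) : bmeas (fun x : T * T => sin (k * x.2)).
Proof.
have [mc [M hM]] := bmeas_sin k; split; last by exists M.
exact: (measurableT_comp mc measurable_snd).
Qed.

Let bgre m : bmeas (gre m \_ I : T -> R).
Proof.
have b : bmeas (fun x : T * T => U x * cos (m%:~R * x.2) + V x * sin (m%:~R * x.2)).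
  by apply: bmeasD; apply: bmeasM.
exact: (bmeas_marginal mI mJ fI fJ b).
Qed.

Let bgim m : bmeas (gim m \_ I : T -> R).
Proof.
have b : bmeas (fun x : T * T => V x * cos (m%:~R * x.2) - U x * sin (m%:~R * x.2)).
  by apply: bmeasB; apply: bmeasM.
exact: (bmeas_marginal mI mJ fI fJ b).
Qed.

Let gre0 : \int[mu]_(t in I) gre 0 t = 0.
Proof.
rewrite -[RHS]U0; apply: eq_Rintegral => t _; rewrite /gre /fre; apply: eq_Rintegral => y _.
by rewrite mul0r cos0 sin0 mulr1 mulr0 addr0.
Qed.

Let gim0 : \int[mu]_(t in I) gim 0 t = 0.
Proof.
rewrite -[RHS]V0; apply: eq_Rintegral => t _; rewrite /gim /fim; apply: eq_Rintegral => y _.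
by rewrite mul0r cos0 sin0 mulr1 mulr0 subr0.
Qed.

Let kapm l m be (a t : R) : R := if 0 < t < pi then kap l m be a t else 0.

Let bkapm l m be a : (absz m <= l)%N -> bmeas (kapm l m be a : T -> R).
Proof.
move=> ml; split; first exact: (measurableT_comp (measurable_kap l m be) (measurable_pair1 (a : T))).
have [M hM] := Kpos_bounded R ml.
exists (M + `|(m == 0)%:R * Ynorm R l 0|) => t; rewrite /kapm; case: ifPn => _; last first.
  by rewrite normr0 addr_ge0 // (le_trans _ (hM 0)).
rewrite /kap (le_trans (ler_normB _ _)) // lerD // normrM ler_piMr //.
by rewrite /chi; case: (_ < _); rewrite ?normr1 ?normr0.
Qed.

(** The part subtracted in [kap] does not depend on t, so it integrates to zero against a [g] of
    mean zero. Cauchy-Schwarz on (0, pi) then produces the factor pi. *)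
Let sqr_le l m be a (g : R -> R) : (absz m <= l)%N -> bmeas (g \_ I : T -> R) ->
  (m = 0 -> \int[mu]_(t in I) g t = 0) ->
  (\int[mu]_(t in I) (Kpos l m (a * tan (t / 2)) * g t)) ^+ 2 <=
   pi * \int[mu]_(t in I) (kapm l m be a t ^+ 2 * (g \_ I) t ^+ 2).
Proof.
move=> ml bg g0; have bk := bkapm be a ml.
pose e : R := (m == 0)%:R * Ynorm R l 0 * chi be a.
have -> : \int[mu]_(t in I) (Kpos l m (a * tan (t / 2)) * g t)
   = \int[mu]_(t in I) (kapm l m be a t * (g \_ I) t).
  transitivity (\int[mu]_(t in I) (kapm l m be a t * (g \_ I) t + e * (g \_ I) t)).
    apply: eq_Rintegral => t tI; rewrite /patch tI /kapm -colatE tI /kap -/e.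
    by ring.
  rewrite bmeas_RintegralD ?bmeas_RintegralZ //; last 2 first.
  - exact: bmeasM.
  - exact: bmeasZ.
  have [m0|m0] := eqVneq m 0; last by rewrite /e (negbTE m0) !mul0r addr0.
  have -> : \int[mu]_(t in I) (g \_ I) t = 0.
    by rewrite -[RHS](g0 m0); apply: eq_Rintegral => t tI; rewrite /patch tI.
  by rewrite mulr0 addr0.
apply: le_trans (@Rintegral_cauchy_schwarz _ T R mu I mI fI _ (bmeasM bk bg)) _.
have -> : fine (mu I) = pi by rewrite mu_colat.
rewrite le_eqVlt; apply/orP; left; apply/eqP; congr (_ * _).
by apply: eq_Rintegral => t _; rewrite exprMn.
Qed.

(** Bessel's inequality contributes 2 pi, and each of the two squares integrates to at most 2 pi (c
    sin t)^2 over the circle. *)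
Let bessel_bound l t : 0 < t < pi ->
  \sum_(i < (2 * l).+1) ((gre (i%:Z - l%:Z) \_ I) t ^+ 2 + (gim (i%:Z - l%:Z) \_ I) t ^+ 2)
  <= 8 * pi ^+ 2 * (c * sin t) ^+ 2.
Proof.
move=> ht.
have bUt := bmeas_section t bU; have bVt := bmeas_section t bV.
have kinj : injective (fun i : 'I_(2 * l).+1 => i%:Z - l%:Z).
  by move=> i j /eqP; rewrite (inj_eq (addIr _)) => /eqP [] /val_inj.
have := bessel bUt bVt kinj; under eq_bigr do rewrite -/(gre _ _) -/(gim _ _).
move=> h; apply: le_trans (le_trans h _).
  rewrite le_eqVlt; apply/orP; left; apply/eqP; apply: eq_bigr => i _.
  by rewrite /patch colatE ht.
have h2 : \int[mu]_(y in J) (U (t, y) ^+ 2 + V (t, y) ^+ 2) <= 2 * (c * sin t) ^+ 2 * (2 * pi).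
  have -> : 2 * pi = fine (mu J) :> R by rewrite mu_circ.
  rewrite -Rintegral_cst //; apply: le_Rintegral => //.
  - apply: (@bmeas_integrable _ T R mu J mJ fJ (fun y => U (t, y) ^+ 2 + V (t, y) ^+ 2)).
    by apply: bmeasD; exact: bmeasX.
  - exact: (@bmeas_integrable _ T R mu J mJ fJ (fun=> _) (bmeas_cst _ _)).
  - move=> y _; have h1 := hU y ht; have h3 := hV y ht.
    have a1 : U (t, y) ^+ 2 <= (c * sin t) ^+ 2.
      by rewrite -real_normK ?num_real // ler_pXn2r ?nnegrE // (le_trans _ h1).
    have a2 : V (t, y) ^+ 2 <= (c * sin t) ^+ 2.
      by rewrite -real_normK ?num_real // ler_pXn2r ?nnegrE // (le_trans _ h3).
    by lra.
have p0 : 0 <= 2 * pi :> R by rewrite mulr_ge0 ?pi_ge0.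
apply: le_trans (ler_wpM2l p0 h2) _.
by rewrite le_eqVlt; apply/orP; left; apply/eqP; ring.
Qed.

Definition coefR l (m : int) (a : R) : R := \int[mu]_(t in I) (Kpos l m (a * tan (t / 2)) * gre m t).
Definition coefI l (m : int) (a : R) : R := \int[mu]_(t in I) (Kpos l m (a * tan (t / 2)) * gim m t).

(** The factor 4 / a stands for (2a)^2 / a^3. In the bound, 416 = 4 * 8 * 13, where 8 comes from
    Bessel and 13 = 9 + 4 from [integral_kap_le]; besides the pi^2 of Bessel, one pi comes from
    Cauchy-Schwarz and one from the length of (0, pi). *)
Lemma integral_coef_le l :
  (\int[mu]_(a in posR) ((\sum_(i < (2 * l).+1)
      (coefR l (i%:Z - l%:Z) a ^+ 2 + coefI l (i%:Z - l%:Z) a ^+ 2)) * 4 / a)%:E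
   <= ((2 * l + 1)%:R * (416 * pi ^+ 4 * c ^+ 2))%:E)%E.
Proof.
pose m (i : 'I_(2 * l).+1) : int := i%:Z - l%:Z.
have ml i : (absz (m i) <= l)%N by rewrite /m; have := ltn_ord i; lia.
have /choice[be hbe] : forall i, exists b : R, forall t, 0 < t < pi ->
    (\int[mu]_(a in posR) (kap l (m i) b a t ^+ 2 / a)%:E <= ((2 * l + 1)%:R * (9 + 4 / sin t))%:E)%E.
  by move=> i; exact: integral_kap_le.
pose k i a t := kapm l (m i) (be i) a t.
pose H i t := (gre (m i) \_ I) t ^+ 2 + (gim (m i) \_ I) t ^+ 2.
have bk i a : bmeas (k i a : T -> R) by exact: bkapm.
have bH i : bmeas (H i : T -> R) by apply: bmeasD; apply: bmeasX; [exact: bgre|exact: bgim].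
have H0 i t : 0 <= H i t by apply: addr_ge0; exact: sqr_ge0.
(* The majorant after Cauchy-Schwarz, nonnegative and jointly measurable, to which Tonelli is
   applied. *)
pose Psi (x : T * T) : \bar R := (4 * pi * \sum_i (k i x.1 x.2 ^+ 2 * H i x.2 * invp x.1))%:E.
have p0 : 0 <= 4 * pi :> R by rewrite mulr_ge0 ?pi_ge0.
have Psi0 x : (0 <= Psi x)%E.
  rewrite lee_fin mulr_ge0 //; apply: sumr_ge0 => i _.
  by rewrite mulr_ge0 ?invp_ge0 // mulr_ge0 ?sqr_ge0.
have mk i : measurable_fun setT (fun x : T * T => k i x.1 x.2) by exact: measurable_kap.
have mPsi : measurable_fun setT Psi.
  apply/measurable_EFinP; apply: measurable_funM; first exact: measurable_cst.
  apply: measurable_sum => i; apply: measurable_funM; last first.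
    exact: (measurableT_comp measurable_invp measurable_fst).
  apply: measurable_funM; first by apply: measurable_funX; exact: mk.
  by have [mH _] := bH i; exact: (measurableT_comp mH measurable_snd).
have step1 a : posR a -> (((\sum_i (coefR l (m i) a ^+ 2 + coefI l (m i) a ^+ 2)) * 4 / a)%:E
    <= \int[mu]_t Psi (a, t))%E.
  move=> a0.
  have bf : bmeas (fun t : T => 4 * pi * \sum_i (k i a t ^+ 2 * H i t * a^-1)).
    apply: bmeasZ; apply: bmeas_sum => i; apply: bmeasM; last exact: bmeas_cst.
    by apply: bmeasM => //; exact: bmeasX.
  have -> : (\int[mu]_t Psi (a, t) = \int[mu]_(t in I) (4 * pi * \sum_i (k i a t ^+ 2 * H i t * a^-1))%:E)%E.
    rewrite [RHS]integral_mkcond; apply: eq_integral => t _; rewrite /Psi /invp /= (_ : 0 < a) //.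
    rewrite /patch colatE; case: ifPn => // ht.
    rewrite big1 ?mulr0 // => i _; rewrite /k /kapm (negbTE ht) expr0n !mul0r //.
  rewrite -(@bmeas_EFin_Rintegral _ T R mu I mI fI _ bf) lee_fin bmeas_RintegralZ //; last first.
    by apply: bmeas_sum => i; apply: bmeasM; [apply: bmeasM => //; exact: bmeasX|exact: bmeas_cst].
  rewrite bmeas_Rintegral_sum //; last first.
    by move=> i; apply: bmeasM; [apply: bmeasM => //; exact: bmeasX|exact: bmeas_cst].
  rewrite -mulrA mulrC -mulrA mulr_sumr mulr_sumr mulr_sumr; apply: ler_sum => i _.
  have bkk : bmeas (fun t : T => k i a t ^+ 2) by exact: bmeasX.
  have -> : \int[mu]_(t in I) (k i a t ^+ 2 * H i t * a^-1) =
     a^-1 * (\int[mu]_(t in I) (k i a t ^+ 2 * (gre (m i) \_ I) t ^+ 2)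
      + \int[mu]_(t in I) (k i a t ^+ 2 * (gim (m i) \_ I) t ^+ 2)).
    rewrite -bmeas_RintegralD //; last 2 first.
    - by apply: bmeasM => //; apply: bmeasX; exact: bgre.
    - by apply: bmeasM => //; apply: bmeasX; exact: bgim.
    rewrite -bmeas_RintegralZ //; last first.
      by apply: bmeasD; apply: bmeasM => //; apply: bmeasX; [exact: bgre|exact: bgim].
    by apply: eq_Rintegral => t _; rewrite /H; ring.
  have h1 : coefR l (m i) a ^+ 2 <= pi * \int[mu]_(t in I) (k i a t ^+ 2 * (gre (m i) \_ I) t ^+ 2).
    by apply: sqr_le => // ->; exact: gre0.
  have h2 : coefI l (m i) a ^+ 2 <= pi * \int[mu]_(t in I) (k i a t ^+ 2 * (gim (m i) \_ I) t ^+ 2).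
    by apply: sqr_le => // ->; exact: gim0.
  have aV : 0 <= a^-1 * 4 by rewrite mulr_ge0 // invr_ge0 ltW.
  have := ler_wpM2l aV (lerD h1 h2).
  move: (\int[mu]_(t in I) _) (\int[mu]_(t in I) _) => x y.
  move: (coefR _ _ _ ^+ 2) (coefI _ _ _ ^+ 2) => z w hh.
  apply: le_trans (le_trans hh _); rewrite le_eqVlt; apply/orP; left; apply/eqP; ring.
have step2 t : 0 < t < pi -> (\int[mu]_a Psi (a, t) <= (4 * pi * ((2 * l + 1)%:R * (104 * pi ^+ 2 * c ^+ 2)))%:E)%E.
  move=> ht; have s0 : 0 < sin t by exact: sin_gt0_pi.
  have mka i : measurable_fun setT (fun a : T => k i a t ^+ 2 * invp a).
    apply: measurable_funM; last exact: measurable_invp.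
    apply: measurable_funX; exact: (measurableT_comp (mk i) (measurable_pair2 (t : T))).
  have ka0 i a : 0 <= k i a t ^+ 2 * invp a by rewrite mulr_ge0 ?sqr_ge0 ?invp_ge0.
  have -> : (\int[mu]_a Psi (a, t) =
     (4 * pi)%:E * \sum_i ((H i t)%:E * \int[mu]_a (k i a t ^+ 2 * invp a)%:E))%E.
    transitivity ((4 * pi)%:E * \int[mu]_a (\sum_i ((H i t)%:E * (k i a t ^+ 2 * invp a)%:E)))%E.
      rewrite -ge0_integralZl_EFin //; last 2 first.
      - by move=> a _; apply: sume_ge0 => i _; rewrite -EFinM lee_fin mulr_ge0.
      - apply: emeasurable_sum => i; apply: emeasurable_funM; first exact: measurable_cst.
        exact/measurable_EFinP.
      apply: eq_integral => a _; rewrite /Psi EFinM; congr (_ * _)%E.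
      rewrite -sumEFin; apply: eq_bigr => i _; rewrite -EFinM; congr EFin => /=.
      by ring.
    congr (_ * _)%E; rewrite ge0_integral_sum //; last 2 first.
    - by move=> i; apply: emeasurable_funM; [exact: measurable_cst|exact/measurable_EFinP].
    - by move=> i a _; rewrite -EFinM lee_fin mulr_ge0.
    apply: eq_bigr => i _; apply: ge0_integralZl_EFin => //; last exact/measurable_EFinP.
    by move=> a _; rewrite lee_fin; exact: ka0.
  rewrite [leRHS]EFinM; apply: lee_wpmul2l; first by rewrite lee_fin.
  apply: (@le_trans _ _ (\sum_i ((H i t)%:E * ((2 * l + 1)%:R * (9 + 4 / sin t))%:E))%E).
    apply: lee_sum => i _; apply: lee_wpmul2l; first by rewrite lee_fin.
    apply: le_trans (hbe i t ht); rewrite [leRHS]integral_mkcond.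
    apply: le_integral_ge0 => a _; first by rewrite lee_fin.
    rewrite /k /kapm ht /invp /patch.
    have -> : (a \in posR) = (0 < a) by apply/idP/idP; rewrite inE.
    by case: ifPn => _ //; rewrite mulr0.
  under eq_bigr do rewrite -EFinM.
  rewrite sumEFin lee_fin -mulr_suml.
  have hB := bessel_bound l ht.
  have W0 : 0 <= (2 * l + 1)%:R * (9 + 4 / sin t) :> R.
    by rewrite mulr_ge0 // addr_ge0 // divr_ge0 // ltW.
  apply: le_trans (ler_wpM2r W0 hB) _.
  (* The factor sin^2 t from Bessel absorbs the 1 / sin t due to the shifted cutoff: 9 sin^2 t + 4
     sin t <= 13. *)
  have -> : 8 * pi ^+ 2 * (c * sin t) ^+ 2 * ((2 * l + 1)%:R * (9 + 4 / sin t)) =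
    (2 * l + 1)%:R * ((8 * pi ^+ 2 * c ^+ 2) * (9 * sin t ^+ 2 + 4 * sin t)).
    move: ((2 * l + 1)%:R) pi (sin t) (lt0r_neq0 s0) => L p s n; by field.
  have -> : 104 * pi ^+ 2 * c ^+ 2 = (8 * pi ^+ 2 * c ^+ 2) * 13 by ring.
  apply: ler_wpM2l => //; apply: ler_wpM2l.
    by apply: mulr_ge0; [apply: mulr_ge0 => //; exact: sqr_ge0|exact: sqr_ge0].
  by have := sin_le1 t; nra.
apply: (@le_trans _ _ (\int[mu]_a \int[mu]_t Psi (a, t))%E).
  rewrite integral_mkcond; apply: le_integral_ge0 => a _.
    apply: erestrict_ge0 => b b0; rewrite lee_fin.
    apply: divr_ge0; last exact: ltW.
    apply: mulr_ge0 => //; apply: sumr_ge0 => i _; apply: addr_ge0; exact: sqr_ge0.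
  rewrite /patch; case: ifPn => [|_]; first by rewrite inE => a0; exact: step1.
  by apply: integral_ge0 => t _; exact: Psi0.
rewrite (fubini_tonelli Psi mPsi Psi0).
pose M : R := 4 * pi * ((2 * l + 1)%:R * (104 * pi ^+ 2 * c ^+ 2)).
apply: (@le_trans _ _ (\int[mu]_t ((cst M%:E) \_ I) t)%E).
  apply: le_integral_ge0 => t _; first by apply: integral_ge0 => a _; exact: Psi0.
  rewrite /patch colatE; case: ifPn => ht; first exact: step2.
  rewrite integral0_eq // => a _; rewrite /Psi big1 ?mulr0 // => i _.
  by rewrite /k /kapm /= (negbTE ht) expr0n !mul0r.
rewrite -integral_mkcond integral_cst //.
suff : (M%:E * mu I <= ((2 * l + 1)%:R * (416 * pi ^+ 4 * c ^+ 2))%:E)%E by [].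
rewrite mu_colat -EFinM lee_fin /M le_eqVlt; apply/orP; left; apply/eqP.
by move: ((2 * l + 1)%:R) (pi : R) => L p; ring.
Qed.
End SchurBound.

(** * From coefficients of the dilated function to integrals over parallels *)

Section Coefficients.
Local Open Scope classical_set_scope.
Variable R : realType.
Local Notation mu := (@lebesgue_measure R).
Local Notation T := (measurableTypeR R).
Local Notation I := (@colat R).
Local Notation J := (@circ R).

(** The parameter domain without the poles: there tan(theta/2) is positive and finite, and on the
    removed part sin theta = 0 makes the integrands vanish. *)
Definition rect (x : R * R) : bool := (0 < x.1 < pi) && (0 <= x.2 < 2 * pi).

Lemma rectE (x : R * R) : (x \in I `*` J) = rect x.
Proof.
apply/idP/idP; rewrite inE /rect /colat /circ /= !in_itv /=; first by move=> [-> ->].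
by move=> /andP[-> ->].
Qed.

Lemma rect_sdom (x : R * R) : rect x -> x \in @sdom R.
Proof.
rewrite /rect inE /sdom /= !in_itv /= => /andP[/andP[/ltW -> /ltW ->] /andP[-> ->]] //.
Qed.

Lemma sdom_pole (x : R * R) : x \in @sdom R -> ~~ rect x -> sin x.1 = 0.
Proof.
rewrite inE /sdom /= !in_itv /= => -[/andP[a b] cd]; rewrite /rect cd andbT negb_and -!leNgt.
move=> /orP[h|h].
  by have -> : x.1 = 0 by [apply/eqP; rewrite eq_le a h]; rewrite sin0.
by have -> : x.1 = pi by [apply/eqP; rewrite eq_le b h]; rewrite sinpi.
Qed.

Lemma measurable_sdom : measurable (@sdom R : set (T * T)).
Proof. by apply: measurableX; exact: measurable_itv. Qed.

Variable C : R.

(** Replaces [w] by 0 where the bound C sin^2 fails. Under [ae_bound] this changes [w] only on a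
    null set of the rectangle, and the bound then holds everywhere. *)
Definition clamp (w : R * R -> R) (x : R * R) : R :=
  if rect x && (`|w x| <= C * sin x.1 ^+ 2) then w x else 0.

Lemma clampN (w : R * R -> R) x : clamp (fun x => - w x) x = - clamp w x.
Proof. by rewrite /clamp normrN; case: ifP; rewrite ?oppr0. Qed.

Lemma measurable_rect : measurable_fun setT (rect : T * T -> bool).
Proof.
apply: measurable_and; apply: measurable_and.
- by apply: measurable_fun_ltr; [exact: measurable_cst|exact: measurable_fst].
- by apply: measurable_fun_ltr; [exact: measurable_fst|exact: measurable_cst].
- by apply: measurable_fun_ler; [exact: measurable_cst|exact: measurable_snd].
- by apply: measurable_fun_ltr; [exact: measurable_snd|exact: measurable_cst].
Qed.

Lemma measurable_fun_rect (w : T * T -> R) : measurable_fun (@sdom R) w ->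
  measurable_fun setT (fun x : T * T => if rect x then w x else 0).
Proof.
move=> mw; have mw' : measurable_fun setT (w \_ (@sdom R)).
  by apply/(measurable_restrictT _ _).1 => //; exact: measurable_sdom.
rewrite (_ : (fun _ => _) = (fun x => if rect x then (w \_ (@sdom R)) x else 0)).
  by apply: measurable_fun_ifT => //; exact: measurable_rect.
by apply/funext => x; case: ifPn => // /rect_sdom h; rewrite /patch h.
Qed.

Lemma measurable_clamp (w : T * T -> R) : measurable_fun (@sdom R) w ->
  measurable_fun setT (clamp w : T * T -> R).
Proof.
move=> /measurable_fun_rect mw.
rewrite (_ : clamp w = (fun x => if `|if rect x then w x else 0| <= C * sin x.1 ^+ 2
   then (if rect x then w x else 0) else 0)).
  apply: measurable_fun_ifT => //.
  apply: measurable_fun_ler; first exact: measurableT_comp.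
  apply: measurable_funM; first exact: measurable_cst.
  apply: measurable_funX.
  have ms : measurable_fun setT (@sin R) by apply: continuous_measurable_fun; exact: continuous_sin.
  exact: (measurableT_comp ms measurable_fst).
by apply/funext => x; rewrite /clamp; case: (rect x) => //=; case: ifP.
Qed.

Hypothesis C0 : 0 <= C.

Definition slope (w : R * R -> R) (x : R * R) : R := clamp w x * tan (x.1 / 2).

(** Since sin t tan(t/2) = 1 - cos t <= 2, one of the two factors sin t pays for the tangent. *)
Lemma slope_le (w : R * R -> R) (t y : R) : 0 < t < pi -> `|slope w (t, y)| <= 2 * C * sin t.
Proof.
move=> ht; have s0 : 0 < sin t by exact: sin_gt0_pi.
have b0 := tan_half_gt0 ht.
have h : `|clamp w (t, y)| <= C * sin t ^+ 2.
  by rewrite /clamp; case: ifPn => [/andP[]//|_]; rewrite normr0 mulr_ge0 ?sqr_ge0.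
rewrite /slope normrM /= (gtr0_norm b0).
apply: le_trans (ler_wpM2r (ltW b0) h) _.
have -> : C * sin t ^+ 2 * tan (t / 2) = C * (sin t * tan (t / 2)) * sin t by ring.
apply: ler_wpM2r; first exact: ltW.
rewrite [2 * C]mulrC; apply: ler_wpM2l => //.
rewrite (sinE_tan ht); move: (tan (t / 2)) b0 => b b0.
have -> : 2 * b / (1 + b ^+ 2) * b = 2 * b ^+ 2 / (1 + b ^+ 2) by ring.
by rewrite ler_pdivrMr ?one_sqr_gt0 //; lra.
Qed.

Lemma bmeas_slope (w : T * T -> R) : measurable_fun (@sdom R) w -> bmeas (slope w : T * T -> R).
Proof.
move=> mw; split.
  rewrite (_ : slope w = (fun x => clamp w x * (if 0 < x.1 < pi then tan (x.1 / 2) else 0))).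
    apply: measurable_funM; first exact: measurable_clamp.
    exact: (measurableT_comp (@measurable_tan_half R) measurable_fst).
  apply/funext => x; rewrite /slope; case: ifPn => // /negbTE h.
  by rewrite (_ : clamp w x = 0) ?mul0r // /clamp /rect h.
exists (2 * C) => -[t y]; have [ht|ht] := boolP (0 < t < pi).
  apply: le_trans (slope_le w y ht) _.
  by apply: ler_piMr; [exact: mulr_ge0|exact: sin_le1].
by rewrite /slope /clamp /rect (negbTE ht) mul0r normr0 mulr_ge0.
Qed.

Definition ae_bound (w : R * R -> R) : Prop :=
  {ae @leb2 R, forall x, rect x -> `|w x| <= C * sin x.1 ^+ 2}.

Lemma integral_rect_slope (w1 w2 : T * T -> R) (f1 f2 : T * T -> R) :
  measurable_fun (@sdom R) w1 -> measurable_fun (@sdom R) w2 ->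
  ae_bound w1 -> ae_bound w2 -> bmeas f1 -> bmeas f2 ->
  (\int[@leb2 R]_x (if rect x then (w1 x * f1 x + w2 x * f2 x) * tan (x.1 / 2) else 0)%:E
   = (\int[mu]_(t in I) \int[mu]_(y in J) (slope w1 (t, y) * f1 (t, y) + slope w2 (t, y) * f2 (t, y)))%:E)%E.
Proof.
move=> mw1 mw2 ae1 ae2 bf1 bf2.
pose h (x : T * T) := slope w1 x * f1 x + slope w2 x * f2 x.
have bh : bmeas h by apply: bmeasD; apply: bmeasM => //; exact: bmeas_slope.
rewrite -(@Rintegral_fubini R I J (@measurable_colat R) (@measurable_circ R) (@mu_colat_lty R) (@mu_circ_lty R) h bh).
rewrite [RHS]integral_mkcond; apply: ae_eq_integral => //.
- apply/measurable_EFinP.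
  rewrite (_ : (fun _ => _) = (fun x : T * T => ((if rect x then w1 x else 0) * f1 x
     + (if rect x then w2 x else 0) * f2 x) * (if 0 < x.1 < pi then tan (x.1 / 2) else 0))); last first.
    apply/funext => x; case: ifPn => [/andP[-> _]//|_]; by rewrite !mul0r addr0 mul0r.
  have [mf1 _] := bf1; have [mf2 _] := bf2.
  apply: measurable_funM; last exact: (measurableT_comp (@measurable_tan_half R) measurable_fst).
  by apply: measurable_funD; apply: measurable_funM => //; exact: measurable_fun_rect.
- apply/(measurable_restrictT _ _).1.
    by apply: measurableX; [exact: measurable_colat|exact: measurable_circ].
  by apply/measurable_EFinP; apply: measurable_funTS; case: bh.
- have ff := ae_filter_ringOfSetsType (@leb2 R).
  apply: filterS2 ae1 ae2 => x h1 h2 _; rewrite /patch rectE; case: ifPn => // rx.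
  congr EFin; rewrite /h /slope /clamp rx h1 // h2 //=; ring.
Qed.

(** With b = tan(t/2) = a tan(tau/2), the factor sin t = 2b / (1 + b^2) splits into 2a, the tangent
    contained in [slope], and the denominator contained in [Qm]. *)
Lemma coef_dil (a : R) l (m : int) (w1 w2 : T * T -> R) : 0 < a -> (absz m <= l)%N ->
  measurable_fun (@sdom R) w1 -> measurable_fun (@sdom R) w2 ->
  ae_bound w1 -> ae_bound w2 ->
  Rsint (fun x => dil a w1 x * Yre l m x + dil a w2 x * Yim l m x) =
  2 * a * \int[mu]_(t in I) (Kpos l m (a * tan (t / 2)) *
    fre (fun y => slope w1 (t, y)) (fun y => slope w2 (t, y)) m).
Proof.
move=> a0 ml mw1 mw2 ae1 ae2.
pose K (t : R) := if 0 < t < pi then Kpos l m (a * tan (t / 2)) else 0.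
have mK : measurable_fun setT (K : T -> R).
  rewrite (_ : K = (fun t => if 0 < t < pi then Kpos l m (a * (if 0 < t < pi then tan (t / 2) else 0)) else 0)).
    apply: measurable_fun_ifT; last exact: measurable_cst.
      by apply: measurable_and; apply: measurable_fun_ltr => //.
    apply: (measurableT_comp (measurable_Kpos l m)).
    by apply: measurable_funM; [exact: measurable_cst|exact: measurable_tan_half].
  by apply/funext => t; rewrite /K; case: ifP.
have bK : bmeas (K : T -> R).
  split => //; have [M hM] := Kpos_bounded R ml; exists M => t; rewrite /K; case: ifPn => // _.
  by rewrite normr0 (le_trans _ (hM 0)).
have bK1 : bmeas (fun x : T * T => K x.1).
  have [_ [M hM]] := bK; split; last by exists M.
  exact: (measurableT_comp mK measurable_fst).
have bc : bmeas (fun x : T * T => cos (m%:~R * x.2)).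
  have [mc [M hM]] := bmeas_cos (m%:~R : R); split; last by exists M.
  exact: (measurableT_comp mc measurable_snd).
have bs : bmeas (fun x : T * T => sin (m%:~R * x.2)).
  have [mc [M hM]] := bmeas_sin (m%:~R : R); split; last by exists M.
  exact: (measurableT_comp mc measurable_snd).
pose f1 (x : T * T) := 2 * a * (K x.1 * cos (m%:~R * x.2)).
pose f2 (x : T * T) := 2 * a * (K x.1 * sin (m%:~R * x.2)).
have bf1 : bmeas f1 by apply: bmeasZ; exact: bmeasM.
have bf2 : bmeas f2 by apply: bmeasZ; exact: bmeasM.
pose h (x : T * T) : R := if rect x then (w1 x * f1 x + w2 x * f2 x) * tan (x.1 / 2) else 0.
have mh : measurable_fun setT h.
  rewrite (_ : h = (fun x : T * T => ((if rect x then w1 x else 0) * f1 x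
     + (if rect x then w2 x else 0) * f2 x) * (if 0 < x.1 < pi then tan (x.1 / 2) else 0))); last first.
    apply/funext => x; rewrite /h; case: ifPn => [/andP[-> _]//|_]; by rewrite !mul0r addr0 mul0r.
  have [mf1 _] := bf1; have [mf2 _] := bf2.
  apply: measurable_funM; last exact: (measurableT_comp (@measurable_tan_half R) measurable_fst).
  by apply: measurable_funD; apply: measurable_funM => //; exact: measurable_fun_rect.
rewrite /Rsint /sint.
have -> : (\int[@leb2 R]_(x in @sdom R) ((dil a w1 x * Yre l m x + dil a w2 x * Yim l m x) * sin x.1)%:E
   = \int[@leb2 R]_x (h (Phi a x.1, x.2) * dPhi a x.1)%:E)%E.
  rewrite integral_mkcond; apply: eq_integral => x _; rewrite /patch.
  have rP : rect (Phi a x.1, x.2) = rect x by rewrite /rect /= Phi_itv.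
  rewrite /h rP; case: (boolP (rect x)) => rx; last first.
    rewrite mul0r; case: ifPn => // xs.
    by rewrite (sdom_pole xs rx) mulr0.
  rewrite rect_sdom //; congr EFin.
  have ht : 0 < x.1 < pi by case/andP: rx.
  have hP : 0 < Phi a x.1 < pi by rewrite Phi_itv.
  rewrite /dil (theta_aE a0 ht) sqrt_kappa // /Yre /Yim /f1 /f2 /K /= hP.
  rewrite -(tan_half_Phi a0 ht) /Kpos (tan_half_gt0 ht) (sinE_tan ht) (cosE_tan ht) /Qm.
  have tE := tan_half_Phi a0 ht.
  have -> : tan (Phi a x.1 / 2) = tan (x.1 / 2) / a by rewrite tE [a * _]mulrC mulfK // lt0r_neq0.
  have n1 := one_sqr_neq0 (tan (x.1 / 2)); have n2 := lt0r_neq0 a0.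
  move: (dPhi a x.1) (w1 _) (w2 _) (Ynorm R l m) (legendreP l m _) => d p q Y L.
  move: (cos (m%:~R * x.2)) (sin (m%:~R * x.2)) (tan (x.1 / 2)) n1 => cc ss b n1.
  by field; rewrite ?n1 ?n2.
rewrite integral_Phi2 // integral_rect_slope //=.
have bS1 := bmeas_slope mw1; have bS2 := bmeas_slope mw2.
have mJ : measurable (J : set T) by exact: measurable_circ.
have fJ : (mu J < +oo)%E by exact: mu_circ_lty.
have mI : measurable (I : set T) by exact: measurable_colat.
have fI : (mu I < +oo)%E by exact: mu_colat_lty.
have bfr : bmeas (fun x : T * T => slope w1 x * cos (m%:~R * x.2) + slope w2 x * sin (m%:~R * x.2)).
  by apply: bmeasD; exact: bmeasM.
pose g (t : R) := fre (fun y => slope w1 (t, y)) (fun y => slope w2 (t, y)) m.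
have bg : bmeas (g \_ I : T -> R) by exact: (bmeas_marginal mI mJ fI fJ bfr).
transitivity (\int[mu]_(t in I) (2 * a * (K t * (g \_ I) t))).
  apply: eq_Rintegral => t tI; rewrite /patch tI mulrA /g /fre.
  rewrite -(@bmeas_RintegralZ _ T R mu J mJ fJ (2 * a * K t)); last exact: (bmeas_section t bfr).
  by apply: eq_Rintegral => y _; rewrite /f1 /f2 /=; ring.
rewrite (@bmeas_RintegralZ _ T R mu I mI fI (2 * a)); last exact: bmeasM.
congr (_ * _); apply: eq_Rintegral => t tI.
by rewrite /patch tI /K -colatE tI.
Qed.

(** Because sin t / (1 + cos t) = tan(t/2), condition (C) is exactly the vanishing of the mean of
    eta tan(t/2). *)
Lemma mean_slope (w : T * T -> R) : measurable_fun (@sdom R) w -> ae_bound w ->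
  sint (fun x => w x / (1 + cos x.1)) = 0%E ->
  \int[mu]_(t in I) \int[mu]_(y in J) slope w (t, y) = 0.
Proof.
move=> mw aw w0; apply: EFin_inj.
have b1 : bmeas (fun _ : T * T => 1 : R) by exact: bmeas_cst.
have b0 : bmeas (fun _ : T * T => 0 : R) by exact: bmeas_cst.
transitivity (\int[@leb2 R]_x (if rect x then (w x * 1 + w x * 0) * tan (x.1 / 2) else 0)%:E)%E.
  rewrite (integral_rect_slope mw mw aw aw b1 b0); congr EFin.
  by apply: eq_Rintegral => t _; apply: eq_Rintegral => y _; rewrite mulr1 mulr0 addr0.
rewrite -[RHS]w0 /sint [RHS]integral_mkcond; apply: eq_integral => x _; rewrite /patch.
case: (boolP (rect x)) => rx; last by case: ifPn => // xs; rewrite (sdom_pole xs rx) mulr0.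
rewrite rect_sdom //; congr EFin.
have ht : 0 < x.1 < pi by case/andP: rx.
have n1 := one_sqr_neq0 (tan (x.1 / 2)).
rewrite mulr1 mulr0 addr0 -mulrA; congr (_ * _).
rewrite (sinE_tan ht) (cosE_tan ht).
have -> : 1 + xb (tan (x.1 / 2)) = 2 / (1 + tan (x.1 / 2) ^+ 2) by rewrite xbE; field.
by move: (tan (x.1 / 2)) n1 => b n1; field.
Qed.

End Coefficients.

(** * The pointwise bound drawn from (A3), and the assembly *)

Lemma norm_le_sin_sqr (R : realType) (C t p q : R) : 0 <= C -> 0 < t < pi ->
  Num.sqrt (p ^+ 2 + q ^+ 2) * ((1 + tan (t / 2) ^+ 2) / (1 - cos t)) <= C ->
  `|p| <= C * sin t ^+ 2.
Proof.
move=> C0 ht; have b0 := tan_half_gt0 ht; rewrite (cosE_tan ht) (sinE_tan ht).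
move: (tan (t / 2)) b0 => b b0; have n1 := one_sqr_neq0 b; have n2 := lt0r_neq0 b0.
have n3 := one_sqr_gt0 b.
(* The weight in (A3) is 2 / sin^2 theta; the factor 2 thus gained is given away. *)
have -> : (1 + b ^+ 2) / (1 - xb b) = 2 / (2 * b / (1 + b ^+ 2)) ^+ 2.
  have -> : 1 - xb b = 2 * b ^+ 2 / (1 + b ^+ 2) by rewrite xbE; field.
  by field; rewrite ?n1 ?n2.
have s0 : 0 < (2 * b / (1 + b ^+ 2)) ^+ 2 by rewrite exprn_gt0 // divr_gt0 // mulr_gt0.
move: ((2 * b / (1 + b ^+ 2)) ^+ 2) s0 => s s0; rewrite mulrA ler_pdivrMr // => h.
have : `|p| <= Num.sqrt (p ^+ 2 + q ^+ 2) by rewrite -sqrtr_sqr ler_sqrt ?lerDl ?sqr_ge0 // addr_ge0 ?sqr_ge0.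
have := sqrtr_ge0 (p ^+ 2 + q ^+ 2); move: (Num.sqrt _) h => r h r0 pr.
by lra.
Qed.

Theorem mainTheorem7 (R : realType) (u v : R * R -> R) :
  (* eta = u + i v in L_2(S^2) *)
  L2S2 u v ->
  (* (A1) *)
  (sint (fun x => (cabs u v x / (1 + cos x.1))%R) < +oo)%E ->
  (* (A2) *)
  (sint (fun x => (cabs u v x * (tan (x.1 / 2) ^+ 2 / (1 + cos x.1)))%R) < +oo)%E ->
  (* (A3) *)
  (ess_sup_S2 (fun x => (cabs u v x * ((1 + tan (x.1 / 2) ^+ 2) / (1 - cos x.1)))%R)
     < +oo)%E ->
  (* (C): both real and imaginary parts of the integral vanish *)
  sint (fun x => u x / (1 + cos x.1)) = 0%E ->
  sint (fun x => v x / (1 + cos x.1)) = 0%E ->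
  (* (G_l)_l is bounded *)
  exists M : R, forall l : nat, (G u v l <= M%:E)%E.
Proof.
move=> [mu_ [mv _]] _ _ A3 hu hv.
set g := (fun x => _) in A3.
have [C C0 hC] : exists2 C : R, 0 <= C & (ess_sup_S2 g <= C%:E)%E.
  move: A3; case: (ess_sup_S2 g) => [r _|//|_]; last by exists 0 => //; exact: leNye.
  by exists `|r| => //; rewrite lee_fin ler_norm.
have ff := ae_filter_ringOfSetsType (@leb2 R).
have {hC}hC := elimT ess_supP hC.
have gE x : rect x -> ((if x \in @sdom R then g x else 0)%:E <= C%:E)%E -> g x <= C.
  by move=> /rect_sdom ->; rewrite lee_fin.
have aeu : ae_bound C u.
  apply: filterS hC => x hx rx; have ht : 0 < x.1 < pi by case/andP: rx.
  exact: (@norm_le_sin_sqr R C x.1 (u x) (v x) C0 ht (gE x rx hx)).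
have aev : ae_bound C v.
  apply: filterS hC => x hx rx; have ht : 0 < x.1 < pi by case/andP: rx.
  apply: (@norm_le_sin_sqr R C x.1 (v x) (u x) C0 ht); rewrite addrC.
  exact: (gE x rx hx).
have aeNu : ae_bound C (fun x => - u x) by apply: filterS aeu => x hx rx; rewrite normrN hx.
have mNu : measurable_fun (@sdom R) (fun x => - u x) by exact: measurableT_comp.
have bU := bmeas_slope C0 mu_; have bV := bmeas_slope C0 mv.
(* The constant of [integral_coef_le] at c = 2C, the value provided by [slope_le]; its factor 2l + 1
   is cancelled by the one in [G]. *)
exists (416 * pi ^+ 4 * (2 * C) ^+ 2) => l.
have L0 : 0 < (2 * l + 1)%:R :> R by rewrite ltr0n addn1.
have := @integral_coef_le R (slope C u) (slope C v) (2 * C) bU bV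
  (fun t y => slope_le C0 u y) (fun t y => slope_le C0 v y)
  (mean_slope C0 mu_ aeu hu) (mean_slope C0 mv aev hv) l.
move=> /(@lee_wpmul2l _ ((2 * l + 1)%:R^-1)%:E _) h.
rewrite /G; apply: le_trans (le_trans (h _) _); last 2 first.
- by rewrite lee_fin invr_ge0 ltW.
- by rewrite -EFinM lee_fin mulKf // lt0r_neq0.
rewrite le_eqVlt; apply/orP; left; apply/eqP; congr (_ * _)%E.
apply: eq_integral => a; rewrite inE /= => a0; congr EFin.
have -> : projnorm2 (dil a u) (dil a v) l = 4 * a ^+ 2 * \sum_(i < (2 * l).+1)
   (coefR (slope C u) (slope C v) l (i%:Z - l%:Z) a ^+ 2 + coefI (slope C u) (slope C v) l (i%:Z - l%:Z) a ^+ 2).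
  rewrite /projnorm2 mulr_sumr; apply: eq_bigr => i _.
  have ml : (absz (i%:Z - l%:Z) <= l)%N by have := ltn_ord i; lia.
  have -> : coefRe (dil a u) (dil a v) l (i%:Z - l%:Z) = 2 * a * coefR (slope C u) (slope C v) l (i%:Z - l%:Z) a.
    exact: (coef_dil C0 a0 ml mu_ mv aeu aev).
  have -> : coefIm (dil a u) (dil a v) l (i%:Z - l%:Z) = 2 * a * coefI (slope C u) (slope C v) l (i%:Z - l%:Z) a.
    (* The imaginary part for u + i v is the real part for v - i u, so [coef_dil] is applied to the
       pair (v, -u). *)
    transitivity (Rsint (fun x => dil a v x * Yre l (i%:Z - l%:Z) x + dil a (fun x => - u x) x * Yim l (i%:Z - l%:Z) x)).
      by congr Rsint; apply/funext => x; rewrite /dil; ring.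
    rewrite (coef_dil C0 a0 ml mv mNu aev aeNu); congr (_ * _).
    apply: eq_Rintegral => t _; congr (_ * _); apply: eq_Rintegral => y _.
    by rewrite /slope clampN; ring.
  by ring.
move: (\sum_(i < _) _) => S; have n := lt0r_neq0 a0; by field.
Qed.
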